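(* Let $\Lambda=\{1,2,\dots\}$ (with all subsets measurable), let $\pi\in\mathscr P_\Lambda$ and write $\pi_j=\pi(\{j\})$. Suppose that one of the following two sets of assumptions holds. (I) For all $\mathbf Y'\in\mathbb R^n$ and all $\beta>0$, the mappings $\lambda\mapsto\theta_\lambda(\mathbf Y')f_\lambda^2(x_i)$, $i=1,\dots,n$, are $\pi$-integrable; $E(\xi_1^2)<\infty$; and there is a function $g_\xi:\mathbb R\to\mathbb R_+$ with $\|g_\xi\|_\infty:=\sup_xg_\xi(x)<\infty$ and $\int_a^{a'}m_\xi(z)\,dz=\int_a^{a'}g_\xi(z)\,dF_\xi(z)$ for all $a,a'\in\mathbb R$. In this case set $\beta_0=4\|g_\xi\|_\infty$. (II) For all $\mathbf Y'\in\mathbb R^n$ and all $\beta>0$, the mappings $\lambda\mapsto\theta_\lambda(\mathbf Y')f_\lambda(x_i)$, $i=1,\dots,n$, are $\pi$-integrable; there exist i.i.d. random variables $\zeta_1,\dots,\zeta_n$ on an enlargement of the underlying probability space such that $\xi_1+\zeta_1$ has the same distribution as $(1+1/n)\xi_1$ and $(\zeta_1,\dots,\zeta_n)$ is independent of $(\xi_1,\dots,\xi_n)$; and, with $L_\zeta(t)=E(e^{t\zeta_1})$, there exist $\beta_0>0$ and, for every $\beta\ge\beta_0$, a functional $\Psi_\beta:\mathscr P'_\Lambda\times\mathscr P'_\Lambda\to\mathbb R$ such that, for every $\beta\ge\beta_0$ and all $\mu,\mu'\in\mathscr P'_\Lambda$, $$\exp\Big(\frac{\|f-\bar f_{\mu'}\|_n^2-\|f-\bar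 f_\mu\|_n^2}{\beta}\Big)\prod_{i=1}^nL_\zeta\Big(\frac{2(\bar f_\mu(x_i)-\bar f_{\mu'}(x_i))}{\beta}\Big)\le\Psi_\beta(\mu,\mu'),$$ the map $\mu\mapsto\Psi_\beta(\mu,\mu')$ is concave and continuous in the total variation norm, and $\Psi_\beta(\mu,\mu)=1$. In this case $\beta_0$ is the number appearing here. Then for any $\beta>0$ with $\beta\ge\beta_0$ the aggregate $\hat f_n$ satisfies $$E\big(\|\hat f_n-f\|_n^2\big)\le\inf_{j\ge1}\Big(\|f_j-f\|_n^2+\frac{\beta\log\pi_j^{-1}}{n}\Big)$$ (with $\log\pi_j^{-1}=+\infty$ if $\pi_j=0$). In particular, if $\pi_j=1/M$ for $j=1,\dots,M$, then for any such $\beta$ $$E\big(\|\hat f_n-f\|_n^2\big)\le\min_{j=1,\dots,M}\|f_j-f\|_n^2+\frac{\beta\log M}{n}.$$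
   Context: Model: $Y_i=f(x_i)+\xi_i$, $i=1,\dots,n$, where $x_1,\dots,x_n$ are non-random elements of a set $\mathcal X$, $f:\mathcal X\to\mathbb R$ is an unknown function, and $\xi_1,\dots,\xi_n$ are i.i.d. zero-mean real random variables with c.d.f. $F_\xi$. Write $\mathbf Y=(Y_1,\dots,Y_n)$ and $m_\xi(x)=-E[\xi_1\mathbf 1(\xi_1\le x)]=\int_x^\infty z\,dF_\xi(z)$. $\mathscr P_\Lambda$ is the set of all probability measures on $\Lambda$ and $\{f_\lambda,\lambda\in\Lambda\}=\{f_j\}_{j\ge1}$ is a given family of (non-random) functions $f_j:\mathcal X\to\mathbb R$. $\mathscr P'_\Lambda$ is the set of all $\mu\in\mathscr P_\Lambda$ such that $\lambda\mapsto f_\lambda(x_i)$ is $\mu$-integrable for $i=1,\dots,n$; for such $\mu$, $\bar f_\mu(x_i)=\int_\Lambda f_\lambda(x_i)\,\mu(d\lambda)$. Norms: for functions $g,h$ on $\{x_1,\dots,x_n\}$, $\|g-h\|_n^2=\frac1n\sum_{i=1}^n(g(x_i)-h(x_i))^2$; for $\mathbf y\in\mathbb R^n$, $\|\mathbf y-f_\lambda\|_n^2=\frac1n\sum_{i=1}^n(y_i-f_\lambda(x_i))^2$. For a prior $\pi\in\mathscr P_\Lambda$ and $\beta>0$, the exponentially weighted aggregate is $$\hat f_n(x)=\int_\Lambda\theta_\lambda(\mathbf Y)f_\lambda(x)\,\pi(d\lambda),\qquad \theta_\lambda(\mathbf y)=\theta_\lambda(\beta,\pi,\mathbf y)=\frac{\exp\{-n\|\mathbf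 y-f_\lambda\|_n^2/\beta\}}{\int_\Lambda\exp\{-n\|\mathbf y-f_w\|_n^2/\beta\}\,\pi(dw)}.$$ *)

(* Defs.v *)
From HB Require Import structures.
From mathcomp Require Import all_boot all_order all_algebra.
From mathcomp Require Import all_classical all_reals all_analysis.

Set Implicit Arguments.
Unset Strict Implicit.
Unset Printing Implicit Defensive.

Import Order.TTheory GRing.Theory Num.Theory.
Import numFieldNormedType.Exports.

Local Open Scope classical_set_scope.
Local Open Scope ring_scope.

Section laws.
Context {R : realType}.

(* X and Y may live on different probability spaces. *)
Definition same_law d d' dE (T : measurableType d) (T' : measurableType d')
    (E : measurableType dE) (P : probability T R) (X : T -> E)
    (P' : probability T' R) (Y : T' -> E) : Prop :=
  forall A : set E, measurable A -> P (X @^-1` A) = P' (Y @^-1` A).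

Definition mutually_independent d (T : measurableType d)
    (P : probability T R) (n : nat) (X : 'I_n -> {RV P >-> R}) : Prop :=
  forall (J : {set 'I_n}) (A : 'I_n -> set R),
    (forall i, i \in J -> measurable (A i)) ->
    P (\bigcap_(i in [set` J]) (X i @^-1` A i)) =
      (\prod_(i in J) P (X i @^-1` A i))%E.

Definition iid d (T : measurableType d) (P : probability T R) (n : nat)
    (X : 'I_n -> {RV P >-> R}) : Prop :=
  mutually_independent X /\ (forall i j, same_law P (X i) P (X j)).

Definition independent_pair d d1 d2 (T : measurableType d)
    (E1 : measurableType d1) (E2 : measurableType d2) (P : probability T R)
    (X : T -> E1) (Y : T -> E2) : Prop :=
  forall (A : set E1) (B : set E2), measurable A -> measurable B ->
    P ((X @^-1` A) `&` (Y @^-1` B)) = (P (X @^-1` A) * P (Y @^-1` B))%E.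

Definition m_fun d (T : measurableType d) (P : probability T R)
    (X : {RV P >-> R}) (z : R) : R :=
  - fine 'E_P[fun w => X w * (X w <= z)%R%:R].

(* Total mass of the variation measure; it does not depend on the Hahn
   decomposition which is picked. *)
Definition tv_norm d (T : measurableType d)
    (nu : {charge set T -> \bar R}) : \bar R :=
  charge_variation (svalP (cid (svalP (cid (Hahn_decomposition nu))))) setT.

Definition tv_dist d (T : measurableType d) (mu mu' : probability T R)
    : \bar R :=
  tv_norm (cadd (charge_of_finite_measure mu)
                (copp (charge_of_finite_measure mu'))).

(* mu = t mu1 + (1 - t) mu2, stated as a relation. *)
Definition is_mixture d (T : measurableType d) (t : R)
    (mu1 mu2 mu : probability T R) : Prop :=
  forall A : set T, measurable A ->
    mu A = (t%:E * mu1 A + (1 - t)%:E * mu2 A)%E.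

End laws.

Section aggregation.
Context {R : realType} {X : Type} {n : nat}.
Context {dL : measure_display} {L : measurableType dL}.
Implicit Types (x : 'I_n -> X) (F : L -> X -> R) (f : X -> R).
Implicit Types (prior mu : probability L R) (beta : R) (y : 'I_n -> R).

(* Squared empirical norm of the difference of two vectors; a function g on X
   enters through its values [g \o x] at the design points. *)
Definition sqdist_n (u v : 'I_n -> R) : R :=
  n%:R^-1 * \sum_(i < n) (u i - v i) ^+ 2.

Definition theta F x beta prior y (l : L) : R :=
  expR (- (n%:R * sqdist_n y (F l \o x)) / beta) /
  \int[prior]_w expR (- (n%:R * sqdist_n y (F w \o x)) / beta).

Definition ewa F x beta prior y : X -> R :=
  fun z => \int[prior]_l (theta F x beta prior y l * F l z).

Definition P'L F x : set (probability L R) :=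
  [set mu | forall i, mu.-integrable setT (fun l => (F l (x i))%:E)].

Definition fbar F mu : X -> R := fun z => \int[mu]_l F l z.

(* The set P'L is convex, so requiring mu in P'L excludes no mixture. *)
Definition concave_on_P'L F x (psi : probability L R -> R) : Prop :=
  forall (t : R) (mu1 mu2 mu : probability L R), 0 <= t <= 1 ->
    P'L F x mu1 -> P'L F x mu2 -> P'L F x mu -> is_mixture t mu1 mu2 mu ->
    t * psi mu1 + (1 - t) * psi mu2 <= psi mu.

Definition tv_continuous_on_P'L F x (psi : probability L R -> R) : Prop :=
  forall mu, P'L F x mu -> forall eps : R, 0 < eps ->
  exists2 delta : R, 0 < delta & forall nu, P'L F x nu ->
    (tv_dist nu mu < delta%:E)%E -> `|psi nu - psi mu| < eps.

End aggregation.

Section assumptions.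
Context {R : realType} {X : Type} {n : nat} (n_gt0 : (0 < n)%N).
Context {dL : measure_display} {L : measurableType dL}.
Context {d : measure_display} {Om : measurableType d} (P : probability Om R).
Variables (x : 'I_n -> X) (f : X -> R) (F : L -> X -> R).
Variables (xi : 'I_n -> {RV P >-> R}) (prior : probability L R) (beta0 : R).

Let i1 : 'I_n := Ordinal n_gt0.

(* The measurability of g is implicit in its being integrated against dF_xi.
   The integrals run over ]a, a'], the Stieltjes convention for dF_xi; the case
   a' < a is trivial here and follows from a <= a' for oriented integrals. *)
Definition assumption_I : Prop :=
  [/\ forall (y' : 'I_n -> R) (beta : R), 0 < beta -> forall i,
        prior.-integrable setT
          (fun l => (theta F x beta prior y' l * F l (x i) ^+ 2)%:E),
      ('E_P[fun w => (xi i1 w ^+ 2)%R] < +oo)%E &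
      exists g : R -> R,
        [/\ measurable_fun setT g, (forall z, 0 <= g z),
            has_ubound (range g),
            (forall a a' : R,
              (\int[lebesgue_measure]_(z in `]a, a']) (m_fun (xi i1) z)%:E =
               \int[distribution P (xi i1)]_(z in `]a, a']) (g z)%:E)%E) &
            beta0 = 4 * sup (range g)]].

(* An enlargement of (Om, P) is a probability space (Om', P') with a measurable
   map pr onto Om carrying P' to P; xi_i is seen on Om' as xi_i \o pr. The
   product of Laplace transforms is taken in \bar R, as they may be infinite. *)
Definition assumption_II : Prop :=
  [/\ forall (y' : 'I_n -> R) (beta : R), 0 < beta -> forall i,
        prior.-integrable setT
          (fun l => (theta F x beta prior y' l * F l (x i))%:E),
      0 < beta0 &
      exists (d' : measure_display) (Om' : measurableType d')
             (P' : probability Om' R) (pr : {mfun Om' >-> Om})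
             (zeta : 'I_n -> {RV P' >-> R}),
        [/\ forall A : set Om, measurable A -> P' (pr @^-1` A) = P A,
            iid zeta,
            same_law P' (fun w => xi i1 (pr w) + zeta i1 w)
                     P (fun w => (1 + n%:R^-1) * xi i1 w),
            independent_pair P'
              (fun w => [the n.-tuple R of mktuple (fun i => zeta i w)])
              (fun w => [the n.-tuple R of mktuple (fun i => xi i (pr w))]) &
            forall beta : R, beta0 <= beta ->
            exists Psi : probability L R -> probability L R -> R,
            forall mu mu' : probability L R, P'L F x mu -> P'L F x mu' ->
              [/\ ((expR ((sqdist_n (f \o x) (fbar F mu' \o x)
                           - sqdist_n (f \o x) (fbar F mu \o x)) / beta))%:E *
                   \prod_(i < n)
                     'M_P' (zeta i1)
                       (2 * (fbar F mu (x i) - fbar F mu' (x i)) / beta)%R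
                   <= (Psi mu mu')%:E)%E,
                  concave_on_P'L F x (Psi ^~ mu'),
                  tv_continuous_on_P'L F x (Psi ^~ mu') &
                  Psi mu mu = 1]]].

End assumptions.

(* Main.v *)
Require Import Defs.
From HB Require Import structures.
From mathcomp Require Import all_boot all_order all_algebra.
From mathcomp Require Import all_classical all_reals all_analysis.
From mathcomp Require Import measurable_realfun lra ring.

Set Implicit Arguments.
Unset Strict Implicit.
Unset Printing Implicit Defensive.

Import Order.TTheory GRing.Theory Num.Theory.
Import numFieldNormedType.Exports.

Local Open Scope classical_set_scope.
Local Open Scope ring_scope.

(* Gibbs variational principle: the posterior minimizes the expected quadratic
   loss plus [beta] times the relative entropy with respect to the prior.
   Comparing it with the atom at [k] gives, for every sample,
   [sum_i (Y_i - fh_i)^2 + sum_i V_i <= sum_i (Y_i - f_k(x_i))^2 - beta ln pi_k],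
   where [V_i] is the posterior variance of [f_j(x_i)].

   Case (I): in expectation this is the claim with a remainder
   [2 E(xi_i (fh_i - f(x_i))) - E V_i] for each [i].  As a function of the [i]-th
   observation [fh_i] has derivative [2 V_i / beta], and [m_xi] is a Stein kernel
   of [xi], so the remainder is at most [(4 |g|_oo / beta - 1) E V_i <= 0].

   Case (II): [c = (xi + zeta) / (1 + 1/n)] has the law of [xi].  Let [D >= 0] be
   the log of the Gibbs mass divided by its [k]-th term.  Convexity of powers and
   the concavity of [Psi] yield
   [(1 + 1/n) E(D c | xi) <= D xi - loss / beta + b], where [beta b] is the claimed
   bound, and [E (D c) = E (D xi)] turns this into [E loss <= beta b]. *)

(** * Densities and independence *)

(** Under (II) neither the noise nor the functions [f_j] are given a second moment, so the square of
    the noise is taken out of the Gibbs exponents, which leaves them affine in the noise. The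
    rescaling by [1 + 1/n] then acts like one extra observation: it adds to each exponent a single
    average loss and a term linear in [zeta], the two ingredients that the hypothesis on [Psi]
    controls for a Dirac mass against the posterior. Since [D] is not known to be integrable, the
    equality of [E (D c)] and [E (D xi)] cannot be subtracted as it stands and is used for
    truncations. Under (I) integrability comes from the pathwise inequality, whose right-hand side
    is quadratic in the noise. The difficulty there is to freeze all noises but one, hence the
    tuples with an erased coordinate and their independence. Independence is mostly applied to
    nonnegative integrands, through Tonelli, before any integrability is known. *)

Section density.
Context d (T : measurableType d) (R : realType) (mu : {measure set T -> \bar R}).
Variable g : T -> R.
Hypotheses (mg : measurable_fun setT g) (g0 : forall x, 0 <= g x).
Local Open Scope ereal_scope.

(** The two proofs are arguments so that the measure structure can be attached to the term
    [mdensity mg g0] itself. *)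
Definition mdensity of measurable_fun setT g & (forall x, (0 <= g x)%R) :=
  fun A : set T => \int[mu]_(x in A) (g x)%:E.

Local Notation nu := (mdensity mg g0).
Import HBNNSimple.

Let nu0 : nu set0 = 0.
Proof. exact: integral_set0. Qed.

Let nu_ge0 A : 0 <= nu A.
Proof. by apply: integral_ge0 => x _; rewrite lee_fin. Qed.

Let nu_sigma_additive : semi_sigma_additive nu.
Proof.
apply: semi_sigma_additive_nng_induced; first exact/measurable_EFinP.
by move=> x; rewrite lee_fin.
Qed.

HB.instance Definition _ :=
  isMeasure.Build _ _ _ nu nu0 nu_ge0 nu_sigma_additive.

(** On indicators this is the definition of the density measure; both sides pass to the limit along
    the same increasing simple functions. *)
Lemma ge0_integral_density (f : T -> \bar R) :
  measurable_fun setT f -> (forall x, 0 <= f x) ->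
  \int[nu]_x f x = \int[mu]_x (f x * (g x)%:E).
Proof.
move=> mf f0; pose h := nnsfun_approx measurableT mf.
have mg' : measurable_fun setT (EFin \o g) by exact/measurable_EFinP.
have mh n : measurable_fun setT (EFin \o h n).
  exact/measurable_EFinP/measurable_funP.
have hf x : (EFin \o h n) x @[n --> \oo] --> f x.
  by apply: cvg_nnsfun_approx => // *; exact: f0.
have nd x : {homo (fun n => (EFin \o h n) x) : a b / (a <= b)%N >-> a <= b}.
  by move=> a b ab; rewrite lee_fin; exact/lefP/nd_nnsfun_approx.
have L : \int[nu]_x (EFin \o h n) x @[n --> \oo] --> \int[nu]_x f x.
  rewrite [X in _ --> X](_ : _ = \int[nu]_x limn (fun n => (EFin \o h n) x)).
    by apply: cvg_monotone_convergence => // n x _; rewrite lee_fin.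
  by apply: eq_integral => x _; apply/esym/cvg_lim.
have L' : \int[mu]_x ((EFin \o h n) x * (g x)%:E) @[n --> \oo]
    --> \int[mu]_x (f x * (g x)%:E).
  rewrite [X in _ --> X](_ : _ =
      \int[mu]_x limn (fun n => (EFin \o h n) x * (g x)%:E)).
    apply: cvg_monotone_convergence => //.
    - by move=> n; exact: emeasurable_funM.
    - by move=> n x _; rewrite mule_ge0 ?lee_fin.
    - by move=> x _ a b ab; rewrite lee_wpmul2r ?lee_fin// -lee_fin; exact: nd.
  apply: eq_integral => x _; apply/esym/cvg_lim => //.
  exact: cvgeZr.
rewrite -(cvg_lim _ L)// -(cvg_lim _ L')//; congr (limn _).
apply/funext => n /=.
have ind r x : 0 <= (r * \1_(h n @^-1` [set r]) x)%:E :> \bar R.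
  exact: nnfun_muleindic_ge0.
have mind r : measurable_fun setT (fun x => (r * \1_(h n @^-1` [set r]) x)%:E).
  by apply/measurable_EFinP; exact: measurable_funM.
transitivity (\int[nu]_x
    (\sum_(r \in range (h n)) (r * \1_(h n @^-1` [set r]) x)%:E)).
  by apply: eq_integral => x _; rewrite /= fimfunE -fsumEFin.
transitivity (\int[mu]_x
    (\sum_(r \in range (h n)) (r * \1_(h n @^-1` [set r]) x)%:E * (g x)%:E)).
  rewrite !ge0_integral_fsum//; last 2 first.
  - by move=> r; exact: emeasurable_funM.
  - by move=> r x _; apply: mule_ge0; [exact: ind|rewrite lee_fin].
  apply: eq_fsbigr => r rh.
  under eq_integral do rewrite EFinM.
  under [RHS]eq_integral do rewrite EFinM -muleA.
  have r0 : (0 <= r)%R by move: rh; rewrite inE => -[t _ <-].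
  rewrite !ge0_integralZl ?lee_fin//; last first.
  - exact/measurable_EFinP.
  - by move=> x _; rewrite mule_ge0 ?lee_fin.
  - by apply: emeasurable_funM => //; exact/measurable_EFinP.
  rewrite integral_indic// setIT; congr *%E.
  rewrite [LHS](_ : _ = \int[mu]_(x in h n @^-1` [set r]) (g x)%:E)//.
  rewrite integral_mkcond; apply: eq_integral => x _.
  by rewrite epatch_indic muleC.
by apply: eq_integral => x _; rewrite -ge0_mule_fsuml// fsumEFin// -fimfunE.
Qed.

End density.

Section tuple_rectangles.
Context d (T : measurableType d) (n : nat).

Definition rectangle (A : 'I_n -> set T) : set (n.-tuple T) :=
  [set v | forall i, A i (tnth v i)].

Definition rectangles : set (set (n.-tuple T)) :=
  [set rectangle A | A in [set A | forall i, measurable (A i)]].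

Lemma measurable_rectangle A :
  (forall i, measurable (A i)) -> measurable (rectangle A).
Proof.
move=> mA.
rewrite (_ : rectangle A = \bigcap_(i in [set: 'I_n]) ((@tnth _ T)^~ i @^-1` A i)).
  apply: fin_bigcap_measurable => // i _.
  by rewrite -[X in measurable X]setTI; exact: measurable_tnth.
by apply/seteqP; split => v /= H i => [_|]; exact: H.
Qed.

Lemma sub_sigma_rectangles : (measurable : set (set (n.-tuple T))) `<=` <<s rectangles >>.
Proof.
apply: smallest_sub; first exact: smallest_sigma_algebra.
move=> B; rewrite -bigcup_seq => -[/= i _] [A mA <-].
apply: sub_sigma_algebra.
(* A generating cylinder is a rectangle whose other sides are the whole space. *)
exists (fun j => if j == i then A else setT) => /=.
  by move=> j; case: ifP.
rewrite setTI; apply/seteqP; split => v /= H; last by move=> j; case: eqP => // ->.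
by have := H i; rewrite eqxx.
Qed.

Lemma tuple_measure_unique (R : realType)
    (m1 m2 : {measure set (n.-tuple T) -> \bar R}) :
  (m1 setT < +oo)%E ->
  (forall A : 'I_n -> set T, (forall i, measurable (A i)) ->
    m1 (rectangle A) = m2 (rectangle A)) ->
  forall B, measurable B -> m1 B = m2 B.
Proof.
move=> m1oo m12 B mB.
apply: (@g_sigma_algebra_measure_unique _ _ _ rectangles _ (fun=> setT)) => //.
- by move=> _ [A mA <-]; exact: measurable_rectangle.
- move=> _; exists (fun=> setT) => //.
  by apply/seteqP; split.
- by rewrite bigcup_const.
- move=> _ _ [A mA <-] [A' mA' <-]; exists (fun i => A i `&` A' i).
    by move=> i; exact: measurableI.
  apply/seteqP; split => v /=.
    by move=> H; split => i; case: (H i).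
  by move=> [H1 H2] i; split.
- by move=> _ [A mA <-]; exact: m12.
- exact: sub_sigma_rectangles.
Qed.

Lemma measurable_mktuple d' (T' : measurableType d') (f : 'I_n -> T' -> T) :
  (forall i, measurable_fun setT (f i)) ->
  measurable_fun setT (fun w => [the n.-tuple T of mktuple (fun i => f i w)]).
Proof.
move=> mf; apply/measurable_fun_tnthP => i.
rewrite (_ : _ \o _ = f i)//; apply/funext => w /=.
by rewrite tnth_mktuple.
Qed.

End tuple_rectangles.

Section independence.
Local Open Scope ereal_scope.
Context d (T : measurableType d) (R : realType) (P : probability T R).

(** Independence makes the joint law the product of the marginals; Tonelli then lets the second
    variable run over a separate sample point [w']. *)
Lemma ge0_integral_independent_pair d1 d2 (E1 : measurableType d1)
    (E2 : measurableType d2) (X : T -> E1) (Y : T -> E2) (h : E1 * E2 -> \bar R) :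
  measurable_fun setT X -> measurable_fun setT Y -> independent_pair P X Y ->
  measurable_fun setT h -> (forall z, 0 <= h z) ->
  \int[P]_w h (X w, Y w) = \int[P]_w \int[P]_w' h (X w, Y w').
Proof.
move=> mX mY XY mh h0.
pose X' : {RV P >-> E1} := HB.pack X (isMeasurableFun.Build _ _ _ _ _ mX).
pose Y' : {RV P >-> E2} := HB.pack Y (isMeasurableFun.Build _ _ _ _ _ mY).
have mXY : measurable_fun setT (fun w => (X w, Y w)) by exact: measurable_fun_pair.
pose Z : {RV P >-> (E1 * E2)%type} :=
  HB.pack (fun w => (X w, Y w)) (isMeasurableFun.Build _ _ _ _ _ mXY).
transitivity (\int[distribution P Z]_z h z).
  by rewrite ge0_integral_distribution.
rewrite (@eq_measure_integral _ _ _ _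
    (distribution P X' \x distribution P Y')); last first.
  by move=> A mA _; apply/esym/product_measure_unique.
rewrite fubini_tonelli1// ge0_integral_distribution//; last 2 first.
- exact: measurable_fun_fubini_tonelli_F.
- by move=> x; exact: integral_ge0.
apply: eq_integral => w _; rewrite /= /fubini_F ge0_integral_distribution//.
exact: measurableT_comp.
Qed.

(** For fixed [A], both sides of the independence identity are finite measures in the event on [V],
    so agreement on rectangles is enough. *)
Lemma independent_pair_tuple dE (E : measurableType dE) dF (F : measurableType dF)
    n (X : T -> F) (V : T -> n.-tuple E) :
  measurable_fun setT X -> measurable_fun setT V ->
  (forall A B, measurable A -> (forall i, measurable (B i)) ->
    P (X @^-1` A `&` V @^-1` rectangle B) =
    P (X @^-1` A) * P (V @^-1` rectangle B)) ->
  independent_pair P X V.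
Proof.
move=> mX mV XV A B mA mB.
have mXA : measurable (X @^-1` A) by rewrite -[X in measurable X]setTI; exact: mX.
have pA : P (X @^-1` A) \is a fin_num by exact: fin_num_measure.
pose c : {nonneg R} := NngNum (fine_ge0 (measure_ge0 P (X @^-1` A))).
pose V' : {RV P >-> n.-tuple E} := HB.pack V (isMeasurableFun.Build _ _ _ _ _ mV).
pose m1 : {measure set (n.-tuple E) -> \bar R} :=
  pushforward (mrestr P mXA) V.
pose m2 : {measure set (n.-tuple E) -> \bar R} := mscale c (distribution P V').
have mV' C : measurable C -> measurable (V @^-1` C).
  by move=> mC; rewrite -[X in measurable X]setTI; exact: (mV measurableT C mC).
have m1E C : m1 mV C = P (X @^-1` A `&` V @^-1` C) by rewrite setIC.
have m2E C : m2 C = P (X @^-1` A) * P (V @^-1` C).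
  rewrite /m2 /mscale /=; congr *%E.
  by rewrite fineK.
rewrite -m1E -m2E; apply: (tuple_measure_unique (m1 := m1 mV) (m2 := m2)) => //.
- by rewrite m1E setIT (le_lt_trans (probability_le1 _ _))// ltry.
- by move=> C mC; rewrite m1E m2E; exact: XV.
Qed.

(** Erased coordinates are set to [0] rather than dropped, so that the remaining ones form a tuple
    of the same length for every [J]. *)
Lemma mutually_independent_rest n (X : 'I_n -> {RV P >-> R}) (k : 'I_n)
    (J : {set 'I_n}) : mutually_independent X -> k \notin J ->
  independent_pair P (X k)
    (fun w => [the n.-tuple R of mktuple (fun i => if i \in J then X i w else 0%R)]).
Proof.
move=> iX kJ; apply: independent_pair_tuple => //.
  apply: (measurable_mktuple
    (f := fun i w => if i \in J then X i w else 0%R)) => i.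
  by case: (i \in J).
move=> A B mA mB.
(* With [A] in slot [k], the two events merge into one intersection over [k |: J]. *)
pose C i := if i == k then A else B i.
have mC i : measurable (C i) by rewrite /C; case: eqP.
set V := (fun w => _).
(* Either every side at an erased coordinate contains [0] and imposes nothing, or the event on the
   tuple is empty. *)
have [B0|/existsNP[i0 nB0]] := pselect (forall i, i \notin J -> B i 0%R); last first.
  have -> : V @^-1` rectangle B = set0.
    apply/seteqP; split => w //= /(_ i0).
    rewrite /V tnth_mktuple; case: ifPn => // iJ.
      by exfalso; apply: nB0; rewrite iJ.
  by rewrite setI0 measure0 mule0.
have HV : V @^-1` rectangle B = \bigcap_(i in [set` J]) (X i @^-1` C i).
  apply/seteqP; split => w /= H i.
    move=> /= iJ; have := H i; rewrite /V tnth_mktuple iJ /C.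
    by case: eqP => // ik; move: kJ; rewrite -ik iJ.
  rewrite /V tnth_mktuple; case: ifPn => iJ; last exact: B0.
  have := H i iJ; rewrite /C /=.
  by case: eqP => // ik; move: kJ; rewrite -ik iJ.
have -> : X k @^-1` A `&` V @^-1` rectangle B =
    \bigcap_(i in [set` (k |: J)%SET]) (X i @^-1` C i).
  rewrite HV; apply/seteqP; split => w /=.
    move=> [Ak H] i /=; rewrite !inE => /orP[/eqP ->|iJ]; last exact: H.
    by rewrite /C eqxx.
  move=> H; split; first by have := H k; rewrite /= !inE eqxx /C eqxx; exact.
  by move=> i /= iJ; apply: H => /=; rewrite !inE iJ orbT.
rewrite HV !iX// big_setU1//=; congr *%E.
by rewrite /C eqxx.
Qed.

Lemma expectation_prod_independent n (X : 'I_n -> {RV P >-> R})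
    (u : 'I_n -> R -> \bar R) : mutually_independent X ->
  (forall i, measurable_fun setT (u i)) -> (forall i z, 0 <= u i z) ->
  \int[P]_w \prod_(i < n) u i (X i w) = \prod_(i < n) \int[P]_w u i (X i w).
Proof.
move=> iX mu u0.
suff H m (J : {set 'I_n}) : #|J| = m -> \int[P]_w \prod_(i in J) u i (X i w) =
    \prod_(i in J) \int[P]_w u i (X i w).
  have := H _ [set: 'I_n]%SET erefl.
  under eq_integral do under eq_bigl do rewrite inE.
  by under eq_bigl do rewrite inE.
elim: m J => [|m IH] J cJ.
  move/cards0_eq : cJ => ->; rewrite big_set0.
  under eq_integral do rewrite big_set0.
  by rewrite integral_cst// [X in _ * X = _](@probability_setT _ _ _ P) mule1.
have /set0Pn[k kJ] : J != finset.set0 by rewrite -card_gt0 cJ.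
have kJ' : k \notin (J :\ k)%SET by rewrite !inE eqxx.
rewrite -(finset.setD1K kJ) big_setU1//= -IH; last first.
  by move: cJ; rewrite (cardsD1 k) kJ => -[].
(* The factors other than the [k]-th depend on the sample only through this tuple, which is
   independent of [X k]. *)
pose V w := [the n.-tuple R of
  mktuple (fun i => if i \in (J :\ k)%SET then X i w else 0%R)].
pose h (z : R * n.-tuple R) :=
  u k z.1 * \prod_(i in (J :\ k)%SET) u i (tnth z.2 i).
have mprod d' (T' : measurableType d') (K : {set 'I_n}) (f : 'I_n -> T' -> \bar R) :
    (forall i, measurable_fun setT (f i)) ->
    measurable_fun setT (fun z => \prod_(i in K) f i z).
  move=> mf; under eq_fun do rewrite -big_enum; elim: (enum K) => [|a s ih].
    by under eq_fun do rewrite big_nil; exact: measurable_cst.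
  by under eq_fun do rewrite big_cons; exact: emeasurable_funM.
have mh : measurable_fun setT h.
  apply: emeasurable_funM; first exact: measurableT_comp.
  apply: mprod => i; apply: measurableT_comp => //.
  by apply: (measurableT_comp (measurable_tnth i)).
have mV : measurable_fun setT V.
  apply: (measurable_mktuple
    (f := fun i w => if i \in (J :\ k)%SET then X i w else 0%R)) => i.
  by case: (i \in _).
transitivity (\int[P]_w h (X k w, V w)).
  apply: eq_integral => w _; rewrite /h /= big_setU1//=; congr *%E.
  by apply: eq_bigr => i iJ; rewrite tnth_mktuple iJ.
rewrite ge0_integral_independent_pair//; last 2 first.
- exact: mutually_independent_rest.
- by move=> z; rewrite /h mule_ge0// prode_ge0.
have mX i : measurable_fun setT (fun w => u i (X i w)) by exact: measurableT_comp.
rewrite /h /=; under eq_integral => w _.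
  rewrite ge0_integralZl//; last 2 first.
  - apply: mprod => i; apply: measurableT_comp => //.
    exact: (measurableT_comp (measurable_tnth i) mV).
  - by move=> w' _; exact: prode_ge0.
  over.
rewrite ge0_integralZr//; last first.
  by apply: integral_ge0 => w _; exact: prode_ge0.
congr *%E; apply: eq_integral => w _.
by apply: eq_bigr => i iJ; rewrite tnth_mktuple iJ.
Qed.

End independence.

(** * Stein kernels *)

Section stein.
Context d (T : measurableType d) (R : realType) (P : probability T R).
Variables (X : {RV P >-> R}).
Hypotheses (intX : P.-integrable setT (EFin \o X)) (EX0 : ('E_P[X] = 0)%E).

(** Integrand of a nonnegative representation of [m_xi]. As the mean is zero, [m_xi(z)] is both
    [E(X 1(X > z))] and [E(- X 1(X <= z))]; the sign of [z] selects the one whose integrand is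
    nonnegative, so that Tonelli applies. *)
Definition stein_kernel (wz : T * R) : R :=
  if 0 <= wz.2 then (if wz.2 < X wz.1 then X wz.1 else 0)
  else (if X wz.1 <= wz.2 then - X wz.1 else 0).

Lemma stein_kernel_ge0 wz : 0 <= stein_kernel wz.
Proof.
rewrite /stein_kernel; case: ifPn => z0; case: ifPn => // zX.
  exact: le_trans (ltW zX).
by rewrite oppr_ge0 (le_trans zX)// ltW// ltNge.
Qed.

Lemma measurable_stein_kernel : measurable_fun setT stein_kernel.
Proof.
have mX : measurable_fun setT (fun wz : T * R => X wz.1) by exact: measurableT_comp.
have m2 : measurable_fun setT (fun wz : T * R => wz.2) by exact: measurable_snd.
apply: measurable_fun_ifT; first exact: measurable_fun_ler.
  by apply: measurable_fun_ifT => //; exact: measurable_fun_ltr.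
apply: measurable_fun_ifT => //; first exact: measurable_fun_ler.
exact: measurableT_comp.
Qed.

Lemma m_funE z : (m_fun X z)%:E = (\int[P]_w (stein_kernel (w, z))%:E)%E.
Proof.
have mle : measurable [set w | X w <= z].
  by rewrite -[X in measurable X]setTI -preimage_itvNyc; exact: measurable_funP.
have intI : P.-integrable setT (fun w => (X w * (X w <= z)%R%:R)%:E).
  apply: (le_integrable _ _ _ intX) => //.
    apply/measurable_EFinP; apply: measurable_funM => //.
    rewrite (_ : (fun _ => _) = \1_[set w | X w <= z]).
      exact: measurable_indic.
    by apply/funext => w; rewrite indicE mem_setE.
  move=> w _; rewrite /= lee_fin normrM ler_piMr//.
  by case: (X w <= z); rewrite ?normr1 ?normr0.
rewrite /m_fun unlock EFinN fineK ?integrable_fin_num//.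
have [z0|z0] := leP 0 z.
  (* Adding the zero mean turns the event [X <= z] into [z < X]. *)
  rewrite (_ : - _ = 'E_P[X] - \int[P]_x (X x * (X x <= z)%R%:R)%:E)%E; last first.
    by rewrite EX0 add0e.
  rewrite unlock -integralB//.
  apply: eq_integral => w _; rewrite /stein_kernel /= z0 -EFinB.
  by rewrite ltNge; case: leP => _ /=; rewrite ?mulr1 ?mulr0 ?subrr ?subr0.
rewrite -integralN//; last exact: integrable_add_def.
apply: eq_integral => w _; rewrite /stein_kernel /= (leNgt 0 z) z0/=.
by case: leP => _ /=; rewrite ?mulr1 ?mulr0 ?oppr0.
Qed.

Lemma m_fun_ge0 z : 0 <= m_fun X z.
Proof.
by rewrite -lee_fin m_funE; apply: integral_ge0 => w _; rewrite lee_fin stein_kernel_ge0.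
Qed.

Lemma measurable_m_fun : measurable_fun setT (m_fun X).
Proof.
apply/measurable_EFinP; rewrite (_ : EFin \o _ =
    fun z => (\int[P]_w (stein_kernel (w, z))%:E)%E); last first.
  by apply/funext => z; rewrite -m_funE.
apply: (measurable_fun_fubini_tonelli_G (EFin \o stein_kernel)).
  by apply/measurable_EFinP; apply: measurable_stein_kernel.
by move=> ?; rewrite lee_fin stein_kernel_ge0.
Qed.

Variables (g : R -> R) (G : R).
Hypotheses (mg : measurable_fun setT g) (g0 : forall z, 0 <= g z)
  (gG : forall z, g z <= G).
Hypothesis mfun_g : forall a b : R,
  (\int[lebesgue_measure]_(z in `]a, b]) (m_fun X z)%:E =
   \int[distribution P X]_(z in `]a, b]) (g z)%:E)%E.

(** The hypothesis equates [m_xi dz] and [g dF] on half-open intervals only; both are measures,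
    finite on each []-n, n]] because [g] is bounded, hence equal on all Borel sets. *)
Lemma ge0_integral_m_fun (psi : R -> R) :
  measurable_fun setT psi -> (forall z, 0 <= psi z) ->
  (\int[lebesgue_measure]_z (psi z * m_fun X z)%:E =
   \int[P]_w (psi (X w) * g (X w))%:E)%E.
Proof.
move=> mpsi psi0.
have mpsi' : measurable_fun setT (EFin \o psi) by exact/measurable_EFinP.
under eq_integral do rewrite EFinM.
transitivity (\int[mdensity (@lebesgue_measure R) measurable_m_fun m_fun_ge0]_z
    (psi z)%:E)%E.
  by rewrite ge0_integral_density// => z; rewrite lee_fin.
(* Lebesgue measure lives on [measurableTypeR R] and the law of [X] on [R]; the push-forward along
   the identity puts both on one type. *)
pose i : measurableTypeR R -> R := id.
have mi : measurable_fun setT i by move=> _ A mA; rewrite setTI.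
pose nu : {measure set R -> \bar R} :=
  pushforward (mdensity (@lebesgue_measure R) measurable_m_fun m_fun_ge0) i.
transitivity (\int[nu mi]_z (psi z)%:E)%E.
  by rewrite ge0_integral_pushforward// => z _; rewrite lee_fin.
transitivity (\int[mdensity (distribution P X) mg g0]_z (psi z)%:E)%E.
  apply: eq_measure_integral => A mA _.
  pose nu' : {measure set R -> \bar R} := mdensity (distribution P X) mg g0.
  apply: (@g_sigma_algebra_measure_unique _ R R (@ocitv R) _
    (fun n => `](- n%:R : R), n%:R]%classic) _ _ (nu mi) nu' _ _ _ A mA) => //.
  - by move=> _ [[a b] _ <-] /=; exact: measurable_itv.
  - by move=> k; exact: is_ocitv.
  - rewrite -subTset => z _; exists (Num.truncn `|z|).+1 => //=.
    rewrite in_itv/=; have := truncnS_gt `|z|; rewrite ltr_norml => /andP[-> /ltW].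
    by [].
  - exact: ocitvI.
  - by move=> _ [[a b] _ <-] /=; exact: mfun_g.
  - move=> n; rewrite [X in (X < _)%E]mfun_g.
    set D := [set` _]; have mD : measurable D by exact: measurable_itv.
    have leG : (\int[distribution P X]_(z in D) (g z)%:E <=
        \int[distribution P X]_(z in D) (cst G%:E) z)%E.
      apply: ge0_le_integral => //.
      + by move=> z _; rewrite lee_fin.
      + exact/measurable_EFinP/measurable_funTS.
      + by move=> z _; rewrite lee_fin.
    apply: (le_lt_trans leG); rewrite integral_cst//= ltey_eq fin_numM//.
    exact: fin_num_measure.
rewrite ge0_integral_density//.
rewrite ge0_integral_distribution//.
- by apply: emeasurable_funM => //; exact/measurable_EFinP.
- by move=> z; rewrite mule_ge0 ?lee_fin.
Qed.

(** The half-open shape matches the two cases of [stein_kernel], [0 <= z < X] and [X <= z < 0]. *)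
Lemma FTC_itvco (phi psi : R -> R) (a b : R) : a < b ->
  (forall t : R, is_derive t 1 phi (psi t)) -> continuous psi ->
  (\int[lebesgue_measure]_(z in `[a, b[) (psi z)%:E = (phi b - phi a)%:E)%E.
Proof.
move=> ab dphi cpsi.
have cphi : continuous phi.
  move=> t; apply: differentiable_continuous; apply/derivable1_diffP.
  exact: ex_derive.
rewrite integral_itv_bndo_bndc; last first.
  by apply: measurable_funTS; apply/measurable_EFinP; exact: continuous_measurable_fun.
rewrite (@continuous_FTC2 _ psi phi)//.
- exact: continuous_subspaceT.
- split; first by move=> t _; exact: ex_derive.
  + by apply: cvg_at_right_filter; exact: cphi.
  + by apply: cvg_at_left_filter; exact: cphi.
- by move=> t _; rewrite derive1E; exact: derive_val.
Qed.

(** Integration by parts: [X (phi X - phi 0)] is the integral of [stein_kernel * psi] over [z],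
    Tonelli turns its mean into the integral of [psi * m_xi], and that is [E(psi(X) g(X))].
    Subtracting [phi 0] is what keeps every integrand nonnegative. *)
Lemma stein_le (phi psi : R -> R) :
  (forall t : R, is_derive t 1 phi (psi t)) -> continuous psi ->
  (forall z, 0 <= psi z) ->
  (\int[P]_w (X w * (phi (X w) - phi 0))%:E <=
   G%:E * \int[P]_w (psi (X w))%:E)%E.
Proof.
move=> dphi cpsi psi0.
have mpsi : measurable_fun setT psi by exact: continuous_measurable_fun.
have mpsi' : measurable_fun setT (EFin \o psi) by exact/measurable_EFinP.
have -> : (\int[P]_w (X w * (phi (X w) - phi 0))%:E =
    \int[P]_w \int[lebesgue_measure]_z (stein_kernel (w, z) * psi z)%:E)%E.
  apply: eq_integral => w _; have [X0|X0|X0] := ltgtP (X w) 0.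
  - transitivity (\int[lebesgue_measure]_(z in `[X w, 0%R[) ((- X w)%:E * (psi z)%:E))%E.
      rewrite ge0_integralZl//.
      + by rewrite (FTC_itvco (phi := phi))// -EFinM mulNr -mulrN opprB.
      + exact: measurable_funTS.
      + by move=> z _; rewrite lee_fin.
      + by rewrite lee_fin oppr_ge0 ltW.
    rewrite integral_mkcond; apply: eq_integral => z _.
    rewrite patchE mem_setE in_itv/= /stein_kernel /= (ltNge z 0).
    case: (leP 0 z) => z0 /=; rewrite ?andbF ?andbT; last first.
      by case: ifP; rewrite ?mul0r// EFinM.
    by rewrite (ltNge z (X w)) (le_trans (ltW X0) z0)/= mul0r.
  - transitivity (\int[lebesgue_measure]_(z in `[0%R, X w[) ((X w)%:E * (psi z)%:E))%E.
      rewrite ge0_integralZl//.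
      + by rewrite (FTC_itvco (phi := phi)).
      + exact: measurable_funTS.
      + by move=> z _; rewrite lee_fin.
      + by rewrite lee_fin ltW.
    rewrite integral_mkcond; apply: eq_integral => z _.
    rewrite patchE mem_setE in_itv/= /stein_kernel /=.
    case: (leP 0 z) => z0 /=.
      by case: ifP; rewrite ?mul0r// EFinM.
    by rewrite ?(leNgt (X w) z) (lt_trans z0 X0)/= mul0r.
  - rewrite X0 mul0r integral0_eq// => z _; rewrite /stein_kernel /= X0 oppr0.
    by case: ifP => z0; case: ifP; rewrite mul0r.
rewrite (fubini_tonelli (m1 := P) (m2 := @lebesgue_measure R)
    (fun wz : T * measurableTypeR R => (stein_kernel wz * psi wz.2)%:E)); last 2 first.
- apply/measurable_EFinP.
  apply: (@measurable_funM _ _ _ _ stein_kernel (fun wz => psi wz.2)).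
    exact: measurable_stein_kernel.
  exact: measurableT_comp.
- by move=> wz; rewrite lee_fin mulr_ge0// stein_kernel_ge0.
have mk z : measurable_fun setT (fun w => stein_kernel (w, z)).
  exact: measurableT_comp measurable_stein_kernel _.
under eq_integral => z _.
  under eq_integral do rewrite /= EFinM.
  rewrite ge0_integralZr//; last 3 first.
  - exact/measurable_EFinP.
  - by move=> w _; rewrite lee_fin stein_kernel_ge0.
  - by rewrite lee_fin.
  rewrite -m_funE -EFinM mulrC; over.
rewrite ge0_integral_m_fun// -ge0_integralZl//; last 3 first.
- by apply: measurableT_comp => //; exact: measurableT_comp.
- by move=> w _; rewrite lee_fin.
- by rewrite lee_fin (le_trans (g0 0)).
apply: ge0_le_integral => //.
- by move=> w _; rewrite lee_fin mulr_ge0.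
- apply/measurable_EFinP; apply: measurable_funM; exact: measurableT_comp.
- apply: emeasurable_funM => //; apply/measurable_EFinP; exact: measurableT_comp.
- by move=> w _; rewrite -EFinM lee_fin mulrC ler_wpM2r.
Qed.

End stein.

(** * Integration over a countable index set *)

Section integral_nat.
Context (R : realType).
Local Open Scope ereal_scope.

Lemma integral_atom (mu : {measure set nat -> \bar R}) (f : nat -> \bar R) k :
  0 <= f k -> \int[mu]_(j in [set k]) f j = f k * mu [set k].
Proof.
move=> f0; rewrite (eq_integral (cst (f k))); last first.
  by move=> j; rewrite inE => ->.
by rewrite integral_cst.
Qed.

Lemma ge0_integral_nat (mu : {measure set nat -> \bar R}) (f : nat -> \bar R) :
  (forall k, 0 <= f k) -> \int[mu]_k f k = \sum_(k <oo) f k * mu [set k].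
Proof.
move=> f0; have UT : \bigcup_k [set k] = [set: nat].
  by apply/seteqP; split => // k _; exists k.
rewrite -[in LHS]UT ge0_integral_bigcup//; last first.
  by move=> i j _ _ [k [/= -> ->]].
by apply: eq_eseriesr => k _; exact: integral_atom.
Qed.

Lemma ge0_integral_nat_atom (mu : {measure set nat -> \bar R})
    (f : nat -> \bar R) k :
  (forall j, 0 <= f j) -> f k * mu [set k] <= \int[mu]_j f j.
Proof.
by move=> f0; rewrite -integral_atom//; exact: ge0_subset_integral.
Qed.

Context d (V : measurableType d) (mu : {measure set nat -> \bar R}).

(** The integral is a series, so measurability at each fixed index stands in for joint
    measurability. *)
Lemma measurable_ge0_integral_nat (h : V -> nat -> \bar R) :
  (forall v j, 0 <= h v j) -> (forall j, measurable_fun setT (h ^~ j)) ->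
  measurable_fun setT (fun v => \int[mu]_j h v j).
Proof.
move=> h0 mh; under eq_fun do rewrite ge0_integral_nat//.
apply: ge0_emeasurable_sum => [k v _ _|k _]; first by rewrite mule_ge0.
exact: emeasurable_funM.
Qed.

Lemma measurable_Rintegral_nat (h : V -> nat -> R) :
  (forall j, measurable_fun setT (h ^~ j)) ->
  measurable_fun setT (fun v => (\int[mu]_j h v j)%R).
Proof.
move=> mh; apply: measurableT_comp => //.
under eq_fun do rewrite integralE.
apply: emeasurable_funB; apply: measurable_ge0_integral_nat => // j.
- rewrite unlock; apply: measurable_maxe => //; exact/measurable_EFinP.
- rewrite unlock; apply: measurable_maxe => //; apply: measurableT_comp => //.
  exact/measurable_EFinP.
Qed.

End integral_nat.

Section rintegral.
Context d (T : measurableType d) (R : realType) (mu : probability T R).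

Lemma integrable_cstP (c : R) : mu.-integrable setT (fun=> c%:E).
Proof. exact: finite_measure_integrable_cst. Qed.

Lemma integrable_ge0_le1 (f : T -> R) : measurable_fun setT f ->
  (forall t, 0 <= f t <= 1) -> mu.-integrable setT (EFin \o f).
Proof.
move=> mf f01; apply: (le_integrable _ _ _ (integrable_cstP 1)) => //.
  exact/measurable_EFinP.
by move=> t _; have /andP[f0 f1] := f01 t; rewrite /= lee_fin normr1 ger0_norm.
Qed.

Lemma EFin_Rintegral (f : T -> R) : mu.-integrable setT (EFin \o f) ->
  (\int[mu]_t f t)%:E = (\int[mu]_t (f t)%:E)%E.
Proof. by move=> intf; rewrite /Rintegral fineK// integrable_fin_num. Qed.

Lemma Rintegral_gt0 (f : T -> R) : mu.-integrable setT (EFin \o f) ->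
  (forall t, 0 < f t) -> 0 < \int[mu]_t f t.
Proof.
move=> intf f0; rewrite lt_neqAle Rintegral_ge0 ?andbT; last first.
  by move=> t _; exact: ltW.
apply/negP => /eqP I0'.
have I0 : (\int[mu]_t (f t)%:E = 0)%E by rewrite -EFin_Rintegral// -I0'.
have mf : measurable_fun setT (EFin \o f) := measurable_int _ intf.
have := ae_eq_integral_abs mu measurableT mf.
rewrite (eq_integral (EFin \o f)); last first.
  by move=> t _ /=; rewrite ger0_norm// ltW.
move=> [/(_ I0) [N [mN N0 subN]] _].
have : mu setT = 0%E.
  apply/eqP; rewrite -measure_le0 -N0; apply: le_measure; rewrite ?inE//.
  move=> t _; apply: subN => /= /(_ I) [ft0].
  by have := f0 t; rewrite ft0 ltxx.
by rewrite probability_setT => /eqP; rewrite onee_eq0.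
Qed.

End rintegral.

(** * Exponential families: the derivative of the mean is the variance *)

Section exponential_family.
Context d (T : measurableType d) (R : realType) (mu : probability T R).
Variables (w a : T -> R) (s : R).
Hypotheses (s0 : 0 <= s) (w0 : forall j, 0 <= w j).
Let f (k : nat) (t : R) (j : T) : R := w j * a j ^+ k * expR (s * t * a j).
Hypothesis intf : forall k t, (k <= 2)%N -> mu.-integrable setT (EFin \o f k t).
Let M k t := \int[mu]_j f k t j.
Hypothesis M0 : forall t, 0 < M 0 t.

Let is_derive_f k (t : R) j : is_derive t 1 ((f k) ^~ j) (s * f k.+1 t j).
Proof.
have H : is_derive t 1 (fun t : R => s * t * a j) (s * a j).
  have H1 : is_derive t 1 ((s * a j) \*: (@id R)) ((s * a j) *: 1).
    exact: is_deriveZ.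
  rewrite (_ : (fun _ => _) = (s * a j) \*: (@id R)); last first.
    by apply/funext => u /=; rewrite /GRing.scale /= mulrAC.
  by apply: is_derive_eq H1 _; rewrite /GRing.scale /= mulr1.
have H2 := is_deriveZ (w j * a j ^+ k) (is_derive1_comp (is_derive_expR _) H).
rewrite (_ : (f k)^~ j =
    (w j * a j ^+ k) \*: (expR \o (fun t => s * t * a j))); last first.
  by apply/funext => u.
apply: is_derive_eq H2 _; rewrite /GRing.scale /= /f exprSr; ring.
Qed.

(** The exponential is monotone in [t] for either sign of [x], so its two end values dominate it in
    between. The resulting bound [dom] keeps the power of [a], hence stays within the moments
    assumed finite. *)
Let expR_between (c t x : R) : c - 1 < t < c + 1 ->
  expR (s * t * x) <= expR (s * (c - 1) * x) + expR (s * (c + 1) * x).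
Proof.
move=> /andP[ct tc]; have [x0|x0] := leP 0 (s * x).
  apply: ler_wpDl; first exact: expR_ge0.
  rewrite ler_expR mulrAC [leRHS]mulrAC ler_wpM2l// ltW//.
apply: ler_wpDr; first exact: expR_ge0.
rewrite ler_expR mulrAC [leRHS]mulrAC ler_wnM2l ?ltW//.
Qed.

Let dom k c j := `|f k (c - 1) j| + `|f k (c + 1) j|.

Let f_le_dom k (c t : R) j : c - 1 < t < c + 1 -> `|f k t j| <= dom k c j.
Proof.
move=> tc; rewrite /dom /f !normrM -mulrDr ler_wpM2l ?mulr_ge0//.
rewrite !ger0_norm ?expR_ge0//; exact: expR_between.
Qed.

Let int_dom k c : (k <= 2)%N -> mu.-integrable setT (EFin \o dom k c).
Proof.
move=> k2; rewrite (_ : EFin \o dom k c = (fun j => `|f k (c - 1) j|%:E) \+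
  (fun j => `|f k (c + 1) j|%:E))%E; last by apply/funext => j; rewrite /= EFinD.
by apply: integrableD => //; apply: (integrable_norm (f := f k _)); exact: intf.
Qed.

(** Differentiation costs one power of [a]: with moments up to order 2, this leaves [k < 2]. *)
Lemma is_derive_moment k (c : R) : (k < 2)%N -> is_derive c 1 (M k) (s * M k.+1 c).
Proof.
move=> k2; have Ic : `]c - 1, c + 1[%classic c.
  by rewrite /= in_itv/=; apply/andP; split; lra.
have d1E t j : partial1of2 (f k) t j = s * f k.+1 t j.
  by rewrite partial1of2E; exact: derive_val.
have df t j : `]c - 1, c + 1[%classic t -> [set: T] j -> derivable ((f k)^~ j) t 1.
  by move=> _ _; exact: ex_derive.
have If t : `]c - 1, c + 1[%classic t -> mu.-integrable setT (EFin \o f k t).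
  by move=> _; apply: intf; exact: ltnW.
have G0 j : 0 <= s * dom k.+1 c j by rewrite mulr_ge0// addr_ge0.
have IG : mu.-integrable setT (EFin \o (fun j => s * dom k.+1 c j)).
  rewrite (_ : EFin \o _ = fun j => (s%:E * (dom k.+1 c j)%:E)%E)//.
  by apply: integrableZl => //; exact: int_dom.
have Gub t j : `]c - 1, c + 1[%classic t -> [set: T] j ->
    `|partial1of2 (f k) t j| <= s * dom k.+1 c j.
  move=> /=; rewrite in_itv/= => tc _; rewrite d1E normrM ger0_norm// ler_wpM2l//.
  exact: f_le_dom.
apply: DeriveDef.
  exact: (derivable_under_integral measurableT Ic If df G0 IG Gub).
rewrite -derive1E (differentiation_under_integral measurableT Ic If df G0 IG Gub).
under eq_Rintegral do rewrite d1E.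
by rewrite RintegralZl//; exact: intf.
Qed.

Lemma continuous_moment k : (k <= 2)%N -> continuous (M k).
Proof.
move=> k2 c; have Ic : c \in `]c - 1, c + 1[%classic.
  by rewrite mem_setE in_itv/=; apply/andP; split; lra.
apply: (@continuity_under_integral _ _ _ mu (f k) setT measurableT (c - 1) (c + 1)
  _ _ (dom k c)) => //.
- by move=> t _; exact: intf.
- apply: aeW => j _ t _.
  apply: differentiable_continuous; apply/derivable1_diffP.
  exact: (@ex_derive _ _ _ _ _ _ _ (is_derive_f k t j)).
- exact: int_dom.
- move=> t; rewrite /= in_itv/= => tc; apply: aeW => j _; exact: f_le_dom.
Qed.

(** Mean and, below, variance of [a] under the probability proportional to
    [w j * expR (s * t * a j)]; up to powers of [s], the first two derivatives of [ln (M 0 t)]. *)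
Definition tilted_mean t := M 1 t / M 0 t.
Definition tilted_variance t := M 2 t / M 0 t - tilted_mean t ^+ 2.

Lemma is_derive_tilted_mean (t : R) :
  is_derive t 1 tilted_mean (s * tilted_variance t).
Proof.
have d1 := is_derive_moment t (isT : (1 < 2)%N).
have d0 := is_derive_moment t (isT : (0 < 2)%N).
have dV := @is_deriveV _ (M 0) t _ 1 (lt0r_neq0 (M0 t)) d0.
have := is_deriveM d1 dV.
move/is_derive_eq; apply.
rewrite /tilted_variance /tilted_mean /GRing.scale /=.
have := lt0r_neq0 (M0 t); move: (M 0 t) (M 1 t) (M 2 t) => m0 m1 m2 m00.
by field.
Qed.

Lemma continuous_tilted_variance : continuous tilted_variance.
Proof.
move=> t.
have cm : {for t, continuous tilted_mean}.
  apply: differentiable_continuous; apply/derivable1_diffP.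
  exact: (@ex_derive _ _ _ _ _ _ _ (is_derive_tilted_mean t)).
have c2 : {for t, continuous (M 2)} by exact: continuous_moment.
have c0 : {for t, continuous (fun t => (M 0 t)^-1)}.
  by apply: continuousV; [rewrite gt_eqF|exact: continuous_moment].
have := continuousM c2 c0; have := continuousM cm cm.
move=> H1 H2; have := continuousB H2 H1.
by rewrite (_ : _ - _ = tilted_variance).
Qed.

(** The centred form is the one that matches [gibbs_var]. *)
Lemma tilted_varianceE t : tilted_variance t =
  (\int[mu]_j (w j * (a j - tilted_mean t) ^+ 2 * expR (s * t * a j))) / M 0 t.
Proof.
set c := tilted_mean t.
have -> : \int[mu]_j (w j * (a j - c) ^+ 2 * expR (s * t * a j)) =
    M 2 t - 2 * c * M 1 t + c ^+ 2 * M 0 t.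
  rewrite /M -!RintegralZl ?intf//.
  rewrite -RintegralB ?intf//; last first.
    rewrite (_ : EFin \o _ = fun j => ((2 * c)%:E * (f 1 t j)%:E)%E)//.
    by apply: integrableZl => //; exact: intf.
  rewrite -RintegralD//; last 2 first.
  - rewrite (_ : EFin \o _ = fun j => ((f 2 t j)%:E - (2 * c)%:E * (f 1 t j)%:E)%E)//.
    apply: integrableB => //; first exact: intf.
    by apply: integrableZl => //; exact: intf.
  - rewrite (_ : EFin \o _ = fun j => ((c ^+ 2)%:E * (f 0 t j)%:E)%E)//.
    by apply: integrableZl => //; exact: intf.
  by apply: eq_Rintegral => j _; rewrite /f; ring.
rewrite /tilted_variance -/c.
have cM : M 1 t = c * M 0 t by rewrite /c /tilted_mean divfK// gt_eqF.
rewrite {}cM; have := lt0r_neq0 (M0 t); clearbody c; move: (M 0 t) (M 2 t) => m0 m2 m00.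
by field.
Qed.

End exponential_family.

(** * Gibbs posteriors *)

Section gibbs.
Context (R : realType) (X : Type) (n : nat) (n_gt0 : (0 < n)%N).
Variables (x : 'I_n -> X) (F : nat -> X -> R) (prior : probability nat R).
Variables (beta : R) (beta_gt0 : 0 < beta).
Implicit Types (y : 'I_n -> R) (i : 'I_n) (j : nat).

Definition gibbs_weight y j : R :=
  expR (- (n%:R * sqdist_n y (F j \o x)) / beta).

Definition gibbs_mass y : R := \int[prior]_j gibbs_weight y j.

Lemma nsqdistE (u v : 'I_n -> R) :
  n%:R * sqdist_n u v = \sum_(i < n) (u i - v i) ^+ 2.
Proof. by rewrite /sqdist_n mulrA divff ?mul1r// pnatr_eq0 -lt0n. Qed.

Lemma thetaE y j : theta F x beta prior y j = gibbs_weight y j / gibbs_mass y.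
Proof. by []. Qed.

Lemma gibbs_weight_gt0 y j : 0 < gibbs_weight y j.
Proof. exact: expR_gt0. Qed.

Lemma gibbs_weight_le1 y j : gibbs_weight y j <= 1.
Proof.
rewrite -expR0 ler_expR mulNr oppr_le0 divr_ge0// ?(ltW beta_gt0)// nsqdistE.
by apply: sumr_ge0 => i _; exact: sqr_ge0.
Qed.

Lemma integrable_gibbs_weight y :
  prior.-integrable setT (EFin \o gibbs_weight y).
Proof.
apply: integrable_ge0_le1 => // j.
by rewrite gibbs_weight_le1 ltW// gibbs_weight_gt0.
Qed.

Lemma gibbs_mass_gt0 y : 0 < gibbs_mass y.
Proof.
apply: Rintegral_gt0; first exact: integrable_gibbs_weight.
by move=> j; exact: gibbs_weight_gt0.
Qed.

Lemma gibbs_mass_ge y j : fine (prior [set j]) * gibbs_weight y j <= gibbs_mass y.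
Proof.
rewrite -lee_fin EFin_Rintegral; last exact: integrable_gibbs_weight.
rewrite EFinM fineK ?fin_num_measure// muleC.
apply: (@ge0_integral_nat_atom _ prior (EFin \o gibbs_weight y)) => k.
by rewrite lee_fin ltW// gibbs_weight_gt0.
Qed.

Lemma theta_gt0 y j : 0 < theta F x beta prior y j.
Proof. by rewrite thetaE divr_gt0 ?gibbs_weight_gt0 ?gibbs_mass_gt0. Qed.

Lemma integrable_theta y :
  prior.-integrable setT (EFin \o theta F x beta prior y).
Proof.
rewrite (_ : EFin \o _ = fun j => ((gibbs_mass y)^-1%:E * (gibbs_weight y j)%:E)%E).
  by apply: integrableZl => //; exact: integrable_gibbs_weight.
by apply/funext => j; rewrite /= thetaE mulrC EFinM.
Qed.

Lemma Rintegral_theta y : \int[prior]_j theta F x beta prior y j = 1.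
Proof.
under eq_Rintegral do rewrite thetaE mulrC.
rewrite RintegralZl//; last exact: integrable_gibbs_weight.
by rewrite mulVf// gt_eqF// gibbs_mass_gt0.
Qed.

Definition gibbs_var y i : R :=
  \int[prior]_j (theta F x beta prior y j *
    (F j (x i) - ewa F x beta prior y (x i)) ^+ 2).

Section measurability.
Context d (U : measurableType d) (Y : U -> 'I_n -> R).
Hypothesis mY : forall i, measurable_fun setT (Y ^~ i).

Lemma measurable_gibbs_weight j : measurable_fun setT (fun u => gibbs_weight (Y u) j).
Proof.
apply: measurableT_comp => //.
under eq_fun do rewrite nsqdistE mulNr.
apply: measurableT_comp => //; apply: measurable_funM => //.
apply: measurable_sum => i; apply: measurable_funX; exact: measurable_funB.
Qed.

Lemma measurable_gibbs_mass : measurable_fun setT (fun u => gibbs_mass (Y u)).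
Proof.
apply: (@measurable_Rintegral_nat _ _ _ _ (fun u j => gibbs_weight (Y u) j)).
exact: measurable_gibbs_weight.
Qed.

Lemma measurable_theta j :
  measurable_fun setT (fun u => theta F x beta prior (Y u) j).
Proof.
apply: measurable_funM; first exact: measurable_gibbs_weight.
apply: (measurable_comp (F := [set r : R | r != 0])).
- exact: open_measurable.
- by move=> _ [u _ <-] /=; rewrite gt_eqF// gibbs_mass_gt0.
- apply: open_continuous_measurable_fun; first exact: openC_eq || exact: open_neq.
  by move=> r; rewrite inE /= => r0; exact: inv_continuous.
- exact: measurable_gibbs_mass.
Qed.

Lemma measurable_ewa z : measurable_fun setT (fun u => ewa F x beta prior (Y u) z).
Proof.
apply: (@measurable_Rintegral_nat _ _ _ _
  (fun u j => theta F x beta prior (Y u) j * F j z)) => j.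
apply: measurable_funM => //; exact: measurable_theta.
Qed.

Lemma measurable_gibbs_var i : measurable_fun setT (fun u => gibbs_var (Y u) i).
Proof.
apply: (@measurable_Rintegral_nat _ _ _ _ (fun u j => theta F x beta prior (Y u) j *
    (F j (x i) - ewa F x beta prior (Y u) (x i)) ^+ 2)) => j.
apply: measurable_funM; first exact: measurable_theta.
apply: measurable_funX; apply: measurable_funB => //; exact: measurable_ewa.
Qed.

End measurability.

Section second_moment.
Hypothesis int2 : forall y i, prior.-integrable setT
  (fun j => (theta F x beta prior y j * F j (x i) ^+ 2)%:E).

Lemma integrable_theta_quadratic y i (c0 c1 c2 : R) : prior.-integrable setT
  (fun j => (theta F x beta prior y j *
    (c0 + c1 * F j (x i) + c2 * F j (x i) ^+ 2))%:E).
Proof.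
(* The linear term is absorbed by [|a| <= 1 + a^2], so the zeroth and second moments dominate. *)
have I : prior.-integrable setT (fun j =>
    ((`|c0| + `|c1|)%:E * (theta F x beta prior y j)%:E +
     (`|c1| + `|c2|)%:E * (theta F x beta prior y j * F j (x i) ^+ 2)%:E)%E).
  apply: integrableD => //; apply: integrableZl => //.
  exact: integrable_theta.
apply: (le_integrable _ _ _ I) => // j _.
rewrite -!EFinM -EFinD /= lee_fin; set t := theta _ _ _ _ _ _; set a := F j (x i).
have t0 : 0 <= t by exact/ltW/theta_gt0.
rewrite [leRHS]ger0_norm; last first.
  by rewrite addr_ge0// mulr_ge0 ?addr_ge0// mulr_ge0 ?sqr_ge0.
rewrite normrM (ger0_norm t0).
have -> : (`|c0| + `|c1|) * t + (`|c1| + `|c2|) * (t * a ^+ 2) =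
  t * (`|c0| + `|c1| * (1 + a ^+ 2) + `|c2| * a ^+ 2) by ring.
apply: ler_wpM2l => //.
apply: (le_trans (ler_normD _ _)); apply: lerD; last first.
  by rewrite normrM (ger0_norm (sqr_ge0 a)).
apply: (le_trans (ler_normD _ _)); rewrite lerD2l normrM ler_wpM2l//.
rewrite ler_norml; apply/andP; split; nra.
Qed.

Lemma integrable_theta1 y i : prior.-integrable setT
  (fun j => (theta F x beta prior y j * F j (x i))%:E).
Proof.
have := integrable_theta_quadratic y i 0 1 0; apply: eq_integrable => // j _.
by congr EFin; ring.
Qed.

Lemma integrable_theta_sq y i (c : R) : prior.-integrable setT
  (fun j => (theta F x beta prior y j * (c - F j (x i)) ^+ 2)%:E).
Proof.
have := integrable_theta_quadratic y i (c ^+ 2) (- 2 * c) 1.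
apply: eq_integrable => // j _.
by congr EFin; ring.
Qed.

Lemma gibbs_var_ge0 y i : 0 <= gibbs_var y i.
Proof.
apply: Rintegral_ge0 => j _.
by apply: mulr_ge0; [exact/ltW/theta_gt0|exact: sqr_ge0].
Qed.

Lemma gibbs_bias_variance y i :
  \int[prior]_j (theta F x beta prior y j * (y i - F j (x i)) ^+ 2) =
  (y i - ewa F x beta prior y (x i)) ^+ 2 + gibbs_var y i.
Proof.
set m := ewa F x beta prior y (x i).
(* Expansion around [m]; the cross term integrates to zero because [m] is the posterior mean. *)
have E j : theta F x beta prior y j * (y i - F j (x i)) ^+ 2 =
    (y i - m) ^+ 2 * theta F x beta prior y j +
    ((2 * (y i - m) * m) * theta F x beta prior y j -
     (2 * (y i - m)) * (theta F x beta prior y j * F j (x i))) +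
    theta F x beta prior y j * (F j (x i) - m) ^+ 2 by ring.
under eq_Rintegral do rewrite E.
have It := integrable_theta y; have I1 := integrable_theta1 y i.
have IZ (c : R) (h : nat -> R) : prior.-integrable setT (EFin \o h) ->
    prior.-integrable setT (EFin \o (fun j => c * h j)).
  by move=> Ih; apply: (integrableZl measurableT c Ih).
have I2 : prior.-integrable setT
    (EFin \o (fun j => theta F x beta prior y j * (F j (x i) - m) ^+ 2)).
  by have := integrable_theta_sq y i m; apply: eq_integrable => // j _; congr EFin; ring.
have IB : prior.-integrable setT (EFin \o (fun j =>
    (2 * (y i - m) * m) * theta F x beta prior y j -
     (2 * (y i - m)) * (theta F x beta prior y j * F j (x i)))).
  by have := integrableB measurableT (IZ _ _ It) (IZ _ _ I1); apply.
have IA : prior.-integrable setT (EFin \o (fun j =>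
    (y i - m) ^+ 2 * theta F x beta prior y j +
    ((2 * (y i - m) * m) * theta F x beta prior y j -
     (2 * (y i - m)) * (theta F x beta prior y j * F j (x i))))).
  by have := integrableD measurableT (IZ _ _ It) IB; apply.
rewrite RintegralD// RintegralD//; last exact: IZ.
rewrite RintegralB//; [|exact: IZ..].
rewrite !RintegralZl// Rintegral_theta -/(gibbs_var y i).
rewrite -[X in _ - _ * X]/(ewa F x beta prior y (x i)) -/m.
by ring.
Qed.

(** Both sides are compared with the free energy [- beta * ln (gibbs_mass y)]: the left-hand side is
    the free energy minus [beta] times a relative entropy, and the right-hand side exceeds it
    because the mass is at least its [k]-th term. *)
Lemma gibbs_variational y k : (0 < prior [set k])%E ->
  \sum_(i < n) ((y i - ewa F x beta prior y (x i)) ^+ 2 + gibbs_var y i) <=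
  \sum_(i < n) (y i - F k (x i)) ^+ 2 - beta * ln (fine (prior [set k])).
Proof.
move=> pk.
have p0 : 0 < fine (prior [set k]) by rewrite fine_gt0// pk ltey_eq fin_num_measure.
pose th := theta F x beta prior y.
pose Q j := \sum_(i < n) (y i - F j (x i)) ^+ 2.
have QE j : gibbs_weight y j = expR (- Q j / beta).
  by rewrite /gibbs_weight nsqdistE.
have IQi i : prior.-integrable setT (EFin \o (fun j => th j * (y i - F j (x i)) ^+ 2)).
  exact: integrable_theta_sq.
have EQ : (fun j => (th j * Q j)%:E) =
    (fun j => (\sum_(i < n) (th j * (y i - F j (x i)) ^+ 2)%:E)%E).
  by apply/funext => j; rewrite sumEFin mulr_sumr.
have IQ : prior.-integrable setT (EFin \o (fun j => th j * Q j)).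
  by rewrite /comp EQ; apply: integrable_sum => // i _; exact: IQi.
have -> : \sum_(i < n) ((y i - ewa F x beta prior y (x i)) ^+ 2 + gibbs_var y i) =
    \int[prior]_j (th j * Q j).
  apply: EFin_inj; rewrite EFin_Rintegral// EQ integral_sum//.
  rewrite -sumEFin; apply: eq_bigr => i _.
  by rewrite -gibbs_bias_variance EFin_Rintegral.
have lnZ : beta * - ln (gibbs_mass y) <= Q k - beta * ln (fine (prior [set k])).
  have : ln (fine (prior [set k]) * gibbs_weight y k) <= ln (gibbs_mass y).
    rewrite ler_ln ?posrE ?gibbs_mass_gt0 ?gibbs_mass_ge//.
    by apply: mulr_gt0 => //; exact: gibbs_weight_gt0.
  rewrite lnM ?posrE ?gibbs_weight_gt0// QE expRK => /(ler_wpM2l (ltW beta_gt0)).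
  rewrite mulrDr mulrN mulNr mulrN mulrCA divff ?gt_eqF// mulr1.
  by move=> H; lra.
apply: le_trans lnZ.
(* Nonnegativity of the entropy in pointwise form: [1 - u <= expR (- u)] at [u = ln (th j)],
   multiplied by [beta * th j]. The last term integrates to zero, [th] having mass one. *)
have pt j : th j * Q j <= beta * - ln (gibbs_mass y) * th j + beta * (1 - th j).
  have Z0 := gibbs_mass_gt0 y.
  have thE : th j = expR (- Q j / beta - ln (gibbs_mass y)).
    by rewrite expRD expRN lnK ?posrE// -QE.
  have := expR_ge1Dx (- (- Q j / beta - ln (gibbs_mass y))).
  rewrite expRN -thE => /(ler_wpM2l (ltW (theta_gt0 y j))).
  rewrite mulfV ?gt_eqF ?theta_gt0// => /(ler_wpM2l (ltW beta_gt0)).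
  rewrite -/(th j) (_ : beta * (th j * _) =
    beta * th j + (beta * beta^-1) * (th j * Q j) + beta * th j * ln (gibbs_mass y)).
    by rewrite divff ?gt_eqF// => H; lra.
  by ring.
have I1 : prior.-integrable setT (EFin \o (fun j => beta * - ln (gibbs_mass y) * th j)).
  exact: (integrableZl measurableT _ (integrable_theta y)).
have I2' : prior.-integrable setT (EFin \o (fun j => 1 - th j)).
  have := integrableB measurableT (integrable_cstP prior 1) (integrable_theta y).
  by apply.
have I2 : prior.-integrable setT (EFin \o (fun j => beta * (1 - th j))).
  exact: (integrableZl measurableT _ I2').
apply: (@le_trans _ _ (\int[prior]_j
    (beta * - ln (gibbs_mass y) * th j + beta * (1 - th j)))).
  apply: le_Rintegral => //.
  by have := integrableD measurableT I1 I2; apply.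
rewrite RintegralD// !RintegralZl//; last exact: integrable_theta.
rewrite RintegralB//; [|exact: integrable_cstP|exact: integrable_theta].
rewrite Rintegral_theta Rintegral_cst// [X in fine X]probability_setT.
by rewrite /= !mul1r subrr mulr0 addr0 mulr1.
Qed.

End second_moment.

End gibbs.

(** * Expectations under equality of laws and independence *)

Lemma maxr0M (R : realDomainType) (a b : R) :
  Num.max (a * b) 0 =
  Num.max a 0 * Num.max b 0 + Num.max (- a) 0 * Num.max (- b) 0.
Proof.
have pos (z : R) : 0 <= z -> Num.max z 0 = z /\ Num.max (- z) 0 = 0.
  by move=> z0; rewrite max_l// max_r// oppr_le0.
have neg (z : R) : z <= 0 -> Num.max z 0 = 0 /\ Num.max (- z) 0 = - z.
  by move=> z0; rewrite max_r// max_l// oppr_ge0.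
case/orP: (le_total 0 a) => a0; case/orP: (le_total 0 b) => b0.
- have [-> ->] := pos _ a0; have [-> ->] := pos _ b0.
  by rewrite (pos _ (mulr_ge0 a0 b0)).1 mulr0 addr0.
- have [-> ->] := pos _ a0; have [-> ->] := neg _ b0.
  by rewrite (neg _ (mulr_ge0_le0 a0 b0)).1 mulr0 mul0r addr0.
- have [-> ->] := neg _ a0; have [-> ->] := pos _ b0.
  by rewrite (neg _ (mulr_le0_ge0 a0 b0)).1 mulr0 mul0r addr0.
- have [-> ->] := neg _ a0; have [-> ->] := neg _ b0.
  by rewrite (pos _ (mulr_le0 a0 b0)).1 mul0r add0r mulrNN.
Qed.

Section laws.
Context d (T : measurableType d) (R : realType) (P : probability T R).
Local Open Scope ereal_scope.

Lemma same_law_integral d' (T' : measurableType d') (P' : probability T' R)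
    dE (E : measurableType dE) (X : T -> E) (Y : T' -> E) (u : E -> \bar R) :
  measurable_fun setT X -> measurable_fun setT Y -> same_law P X P' Y ->
  measurable_fun setT u -> (forall z, 0 <= u z) ->
  \int[P]_w u (X w) = \int[P']_w u (Y w).
Proof.
move=> mX mY XY mu u0.
pose X' : {RV P >-> E} := HB.pack X (isMeasurableFun.Build _ _ _ _ _ mX).
pose Y' : {RV P' >-> E} := HB.pack Y (isMeasurableFun.Build _ _ _ _ _ mY).
transitivity (\int[distribution P X']_z u z).
  by rewrite ge0_integral_distribution.
rewrite (@eq_measure_integral _ _ _ _ (distribution P' Y')).
  by rewrite ge0_integral_distribution.
by move=> A mA _; exact: XY.
Qed.

Lemma ge0_expectation_independentM d2 (E2 : measurableType d2) (X : T -> R)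
    (V : T -> E2) (u : R -> R) (c : E2 -> R) :
  measurable_fun setT X -> measurable_fun setT V -> independent_pair P X V ->
  measurable_fun setT u -> (forall z, (0 <= u z)%R) ->
  measurable_fun setT c -> (forall z, (0 <= c z)%R) ->
  \int[P]_w (u (X w) * c (V w))%:E =
  (\int[P]_w (u (X w))%:E) * \int[P]_w (c (V w))%:E.
Proof.
move=> mX mV XV mu u0 mc c0.
rewrite (@ge0_integral_independent_pair _ _ _ P _ _ _ _ X V
  (fun z => (u z.1 * c z.2)%:E))//; last 2 first.
- apply/measurable_EFinP; apply: measurable_funM; exact: measurableT_comp.
- by move=> z; rewrite lee_fin mulr_ge0.
have mcV : measurable_fun setT (fun w => (c (V w))%:E).
  by apply/measurable_EFinP; exact: measurableT_comp.
have muX : measurable_fun setT (fun w => (u (X w))%:E).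
  by apply/measurable_EFinP; exact: measurableT_comp.
under eq_integral => w _.
  under eq_integral do rewrite /= EFinM.
  rewrite ge0_integralZl// ?lee_fin//; last by move=> w' _; rewrite lee_fin.
  over.
rewrite ge0_integralZr//; last by apply: integral_ge0 => w _; rewrite lee_fin.
by move=> w _; rewrite lee_fin.
Qed.

Lemma integral_centered_independent d2 (E2 : measurableType d2) (X : T -> R)
    (V : T -> E2) (c : E2 -> R) :
  measurable_fun setT V -> independent_pair P X V -> measurable_fun setT c ->
  P.-integrable setT (EFin \o X) -> \int[P]_w (X w)%:E = 0 ->
  P.-integrable setT (fun w => (X w * c (V w))%:E) ->
  \int[P]_w (X w * c (V w))%:E = 0.
Proof.
move=> mV XV mc iX EX0 iXc.
have mX : measurable_fun setT X by apply/measurable_EFinP; exact: measurable_int iX.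
pose p (r : R) := Num.max r 0%R; pose q (r : R) := Num.max (- r)%R 0%R.
have mp : measurable_fun setT p by exact: measurable_maxr.
have mq : measurable_fun setT q.
  by apply: measurable_maxr => //; exact: measurableT_comp.
have p0 r : (0 <= p r)%R by rewrite le_max lexx orbT.
have q0 r : (0 <= q r)%R by rewrite le_max lexx orbT.
have pE (h : T -> R) : (fun w => (h w)%:E)^\+ = fun w => (p (h w))%:E.
  by apply/funext => w; rewrite unlock /p EFin_max.
have qE (h : T -> R) : (fun w => (h w)%:E)^\- = fun w => (q (h w))%:E.
  by apply/funext => w; rewrite unlock /q EFin_max.
have EM (u v : R -> R) : measurable_fun setT u -> (forall r, (0 <= u r)%R) ->
    measurable_fun setT v -> (forall r, (0 <= v r)%R) ->
    \int[P]_w (u (X w) * v (c (V w)))%:E =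
    \int[P]_w (u (X w))%:E * \int[P]_w (v (c (V w)))%:E.
  move=> mu u0 mv v0.
  have mvc : measurable_fun setT (v \o c) := measurableT_comp mv mc.
  by apply: (@ge0_expectation_independentM _ _ X V u (v \o c)) => // z; exact: v0.
have ED (u v u' v' : R -> R) : measurable_fun setT u -> (forall r, (0 <= u r)%R) ->
    measurable_fun setT v -> (forall r, (0 <= v r)%R) ->
    measurable_fun setT u' -> (forall r, (0 <= u' r)%R) ->
    measurable_fun setT v' -> (forall r, (0 <= v' r)%R) ->
    \int[P]_w (u (X w) * v (c (V w)) + u' (X w) * v' (c (V w)))%:E =
    \int[P]_w (u (X w))%:E * \int[P]_w (v (c (V w)))%:E +
    \int[P]_w (u' (X w))%:E * \int[P]_w (v' (c (V w)))%:E.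
  move=> mu u0 mv v0 mu' u'0 mv' v'0; under eq_integral do rewrite EFinD.
  have m (f g : R -> R) : measurable_fun setT f -> measurable_fun setT g ->
      measurable_fun setT (fun w => (f (X w) * g (c (V w)))%:E).
    move=> mf mg; apply/measurable_EFinP; apply: measurable_funM.
      exact: measurableT_comp.
    by apply: measurableT_comp => //; exact: measurableT_comp.
  rewrite ge0_integralD// ?EM//; try exact: m;
    by move=> w _; rewrite lee_fin mulr_ge0.
have Xpq : \int[P]_w (p (X w))%:E = \int[P]_w (q (X w))%:E.
  move: EX0; rewrite integralE pE qE.
  have f1 : \int[P]_w (p (X w))%:E \is a fin_num.
    by have := integrable_pos_fin_num measurableT iX; rewrite pE.
  have f2 : \int[P]_w (q (X w))%:E \is a fin_num.
    by have := integrable_neg_fin_num measurableT iX; rewrite qE.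
  by move/eqP; rewrite sube_eq ?add0e ?fin_num_adde_defr// => /eqP.
have f1 := integrable_pos_fin_num measurableT iXc.
rewrite integralE.
suff -> : \int[P]_w (fun w => (X w * c (V w))%:E)^\- w =
    \int[P]_w (fun w => (X w * c (V w))%:E)^\+ w by rewrite subee.
rewrite pE qE.
transitivity (\int[P]_w (p (X w) * q (c (V w)) + q (X w) * p (c (V w)))%:E).
  by apply: eq_integral => w _; congr EFin; rewrite /p /q -mulrN maxr0M opprK.
transitivity (\int[P]_w (p (X w) * p (c (V w)) + q (X w) * q (c (V w)))%:E).
  by rewrite !ED// Xpq addeC.
by apply: eq_integral => w _; congr EFin; rewrite /p /q maxr0M.
Qed.

End laws.

(** * Dependence of the posterior on one observation *)

Section gibbs_coordinate.
Context (R : realType) (X : Type) (n : nat) (n_gt0 : (0 < n)%N).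
Variables (x : 'I_n -> X) (F : nat -> X -> R) (prior : probability nat R).
Variables (beta : R) (beta_gt0 : 0 < beta).
Implicit Types (y : 'I_n -> R) (j : nat).
Hypothesis int2 : forall y i, prior.-integrable setT
  (fun j => (theta F x beta prior y j * F j (x i) ^+ 2)%:E).

Definition upd (i : 'I_n) (t : R) y : 'I_n -> R := fun k => if k == i then t else y k.

Variables (c : R) (i : 'I_n) (y : 'I_n -> R).

(** When the [i]-th observation is [c + t], its squared residual is [t^2 - 2 t a + a^2]. The first
    term is common to all [j] and cancels in [theta], the second is a tilt with [s = 2 / beta], and
    [w] collects the rest: an exponential family in [t]. *)
Let a j := F j (x i) - c.
Let w j := expR (- (a j ^+ 2 + \sum_(k < n | k != i) (y k - F j (x k)) ^+ 2) / beta).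
Let s := 2 / beta.
Let M (k : nat) (t : R) := \int[prior]_j (w j * a j ^+ k * expR (s * t * a j)).

Let gibbs_weight_upd t j : gibbs_weight x F beta (upd i (c + t) y) j =
  expR (- t ^+ 2 / beta) * (w j * expR (s * t * a j)).
Proof.
rewrite /gibbs_weight nsqdistE// (bigD1 i)//= /upd eqxx.
rewrite (eq_bigr (fun k => (y k - F j (x k)) ^+ 2)); last first.
  by move=> k /negPf ->.
rewrite /w -!expRD; congr expR; rewrite /s /a.
have : beta != 0 by rewrite gt_eqF.
move: (F j (x i)) (\sum_(k < n | _) _) => b S b0.
by field.
Qed.

Let gibbs_mass_upd t : gibbs_mass x F prior beta (upd i (c + t) y) =
  expR (- t ^+ 2 / beta) * M 0 t.
Proof.
rewrite /gibbs_mass /M; under eq_Rintegral do rewrite gibbs_weight_upd.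
rewrite RintegralZl//.
  by congr *%R; apply: eq_Rintegral => j _; rewrite expr0 mulr1.
have := integrable_gibbs_weight n_gt0 x F prior beta_gt0 (upd i (c + t) y).
move=> /(integrableZl measurableT (expR (- t ^+ 2 / beta))^-1).
apply: eq_integrable => // j _.
by rewrite /= -EFinM gibbs_weight_upd mulKf// gt_eqF// expR_gt0.
Qed.

Let M0_gt0 t : 0 < M 0 t.
Proof.
have := gibbs_mass_gt0 n_gt0 x F prior beta_gt0 (upd i (c + t) y).
by rewrite gibbs_mass_upd pmulr_rgt0// expR_gt0.
Qed.

Let theta_upd t j : theta F x beta prior (upd i (c + t) y) j =
  w j * expR (s * t * a j) / M 0 t.
Proof.
rewrite thetaE gibbs_weight_upd gibbs_mass_upd.
by rewrite -mulf_div divff ?mul1r// gt_eqF// expR_gt0.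
Qed.

Let int_moment k t : (k <= 2)%N ->
  prior.-integrable setT (EFin \o (fun j => w j * a j ^+ k * expR (s * t * a j))).
Proof.
move=> k2.
have : prior.-integrable setT
    (fun j => (theta F x beta prior (upd i (c + t) y) j * a j ^+ k)%:E).
  have Q := integrable_theta_quadratic n_gt0 beta_gt0 int2 (upd i (c + t) y) i.
  move: k k2 => [|[|[|//]]] _.
  - have := Q 1 0 0; apply: eq_integrable => // j _; congr EFin; rewrite /a; ring.
  - have := Q (- c) 1 0; apply: eq_integrable => // j _; congr EFin; rewrite /a; ring.
  - have := Q (c ^+ 2) (- 2 * c) 1; apply: eq_integrable => // j _; congr EFin.
    rewrite /a; ring.
move=> /(integrableZl measurableT (M 0 t)); apply: eq_integrable => // j _.
rewrite /= -EFinM theta_upd; congr EFin.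
have := lt0r_neq0 (M0_gt0 t); move: (M 0 t) (w j) (a j ^+ k) (expR _) => *.
by field.
Qed.

Let phi (t : R) := ewa F x beta prior (upd i (c + t) y) (x i) - c.
Let psi (t : R) := gibbs_var x F prior beta (upd i (c + t) y) i.

Let phiE t : phi t = tilted_mean prior w a s t.
Proof.
rewrite /phi /ewa /tilted_mean -/(M 1 t) -/(M 0 t).
have E j : theta F x beta prior (upd i (c + t) y) j * F j (x i) =
  (M 0 t)^-1 * (w j * a j ^+ 1 * expR (s * t * a j)) +
  c * theta F x beta prior (upd i (c + t) y) j.
  by rewrite theta_upd /a; ring.
have IT := integrable_theta n_gt0 x F prior beta_gt0 (upd i (c + t) y).
have I1 : prior.-integrable setT (EFin \o (fun j =>
    (M 0 t)^-1 * (w j * a j ^+ 1 * expR (s * t * a j)))).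
  exact: (integrableZl measurableT _ (int_moment t (isT : (1 <= 2)%N))).
have I2 : prior.-integrable setT (EFin \o (fun j =>
    c * theta F x beta prior (upd i (c + t) y) j)).
  exact: (integrableZl measurableT _ IT).
under eq_Rintegral do rewrite E.
rewrite RintegralD// !RintegralZl//; last exact: int_moment.
by rewrite Rintegral_theta// mulr1 addrK mulrC.
Qed.

Let psiE t : psi t = tilted_variance prior w a s t.
Proof.
rewrite tilted_varianceE//.
rewrite -phiE -/(M 0 t) /psi /gibbs_var mulrC.
rewrite -RintegralZl//; last first.
  have := integrable_theta_sq n_gt0 beta_gt0 int2 (upd i (c + t) y) i
    (ewa F x beta prior (upd i (c + t) y) (x i)).
  move=> /(integrableZl measurableT (M 0 t)); apply: eq_integrable => // j _.
  rewrite /= -EFinM theta_upd; congr EFin; rewrite /phi /a.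
  have := lt0r_neq0 (M0_gt0 t); move: (M 0 t) => m m0.
  by field.
apply: eq_Rintegral => j _; rewrite theta_upd /phi /a; ring.
Qed.

Lemma is_derive_ewa_coordinate (t : R) : is_derive t 1 phi (s * psi t).
Proof.
rewrite psiE (_ : phi = tilted_mean prior w a s); last first.
  by apply/funext => u; rewrite phiE.
by apply: is_derive_tilted_mean => //; rewrite divr_ge0 ?ltW.
Qed.

Lemma continuous_gibbs_var_coordinate : continuous psi.
Proof.
rewrite (_ : psi = tilted_variance prior w a s); last first.
  by apply/funext => u; rewrite psiE.
by apply: continuous_tilted_variance => //; rewrite divr_ge0 ?ltW.
Qed.

End gibbs_coordinate.

Section real_integrable.
Context d (T : measurableType d) (R : realType) (mu : probability T R).
Implicit Types (f g : T -> R).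

Lemma integrableD_fun f g : mu.-integrable setT (EFin \o f) ->
  mu.-integrable setT (EFin \o g) ->
  mu.-integrable setT (EFin \o (fun t => f t + g t)).
Proof. by move=> If Ig; have := integrableD measurableT If Ig; apply. Qed.

Lemma integrableB_fun f g : mu.-integrable setT (EFin \o f) ->
  mu.-integrable setT (EFin \o g) ->
  mu.-integrable setT (EFin \o (fun t => f t - g t)).
Proof. by move=> If Ig; have := integrableB measurableT If Ig; apply. Qed.

Lemma integrableZ_fun f (c : R) : mu.-integrable setT (EFin \o f) ->
  mu.-integrable setT (EFin \o (fun t => c * f t)).
Proof. by move=> If; have := integrableZl measurableT c If; apply. Qed.

Lemma integrable_sum_fun n (f : 'I_n -> T -> R) :
  (forall i, mu.-integrable setT (EFin \o f i)) ->
  mu.-integrable setT (EFin \o (fun t => \sum_(i < n) f i t)).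
Proof.
move=> If; rewrite (_ : EFin \o _ = fun t => (\sum_(i < n) (f i t)%:E)%E).
  by apply: integrable_sum => // i _; exact: If.
by apply/funext => t; rewrite /= sumEFin.
Qed.

Lemma Rintegral_sum n (f : 'I_n -> T -> R) :
  (forall i, mu.-integrable setT (EFin \o f i)) ->
  \int[mu]_t (\sum_(i < n) f i t) = \sum_(i < n) \int[mu]_t f i t.
Proof.
move=> If; apply: EFin_inj; rewrite EFin_Rintegral; last exact: integrable_sum_fun.
under eq_integral do rewrite -sumEFin.
rewrite integral_sum// -sumEFin; apply: eq_bigr => i _.
by rewrite EFin_Rintegral.
Qed.

Lemma Rintegral_cstP (c : R) : \int[mu]_t c = c.
Proof.
by rewrite Rintegral_cst// [X in fine X](@probability_setT _ _ _ mu) mulr1.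
Qed.

Lemma integrable_dom f g : measurable_fun setT f ->
  mu.-integrable setT (EFin \o g) -> (forall t, `|f t| <= g t) ->
  mu.-integrable setT (EFin \o f).
Proof.
move=> mf Ig fg; apply: (le_integrable _ _ _ Ig) => //; first exact/measurable_EFinP.
by move=> t _; rewrite /= lee_fin (le_trans (fg t))// ler_norm.
Qed.

Lemma integrable_ge0_lty f : measurable_fun setT f -> (forall t, 0 <= f t) ->
  (\int[mu]_t (f t)%:E < +oo)%E -> mu.-integrable setT (EFin \o f).
Proof.
move=> mf f0 foo; apply/integrableP; split; first exact/measurable_EFinP.
by under eq_integral => t _ do rewrite /= ger0_norm//.
Qed.

End real_integrable.

(** [phi] is nondecreasing. This sign lets independence be applied to the increment by Tonelli. *)
Lemma increment_ge0 (R : realType) (phi psi : R -> R) :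
  (forall t : R, is_derive t 1 phi (psi t)) -> continuous psi ->
  (forall z, 0 <= psi z) -> forall t, 0 <= t * (phi t - phi 0).
Proof.
move=> dphi cpsi psi0 t; have [t0|t0|->] := ltgtP t 0; last by rewrite mul0r.
- rewrite -mulrNN opprB mulr_ge0 ?oppr_ge0 ?(ltW t0)// -lee_fin.
  rewrite -(FTC_itvco t0 dphi cpsi); apply: integral_ge0 => z _.
  by rewrite lee_fin.
- rewrite mulr_ge0 ?(ltW t0)// -lee_fin -(FTC_itvco t0 dphi cpsi).
  by apply: integral_ge0 => z _; rewrite lee_fin.
Qed.

(** * Risk bound under (I) *)

Section case_I.
Context (R : realType) (X : Type) (n : nat) (n_gt0 : (0 < n)%N).
Context (d : measure_display) (Om : measurableType d) (P : probability Om R).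
Variables (x : 'I_n -> X) (f : X -> R) (F : nat -> X -> R).
Variables (xi : 'I_n -> {RV P >-> R}) (xi_iid : iid xi).
Hypothesis xi_integrable : forall i, P.-integrable setT (fun w => (xi i w)%:E).
Hypothesis xi_mean0 : forall i, ('E_P[xi i] = 0)%E.
Variables (prior : probability nat R) (beta : R) (beta_gt0 : 0 < beta).
Hypothesis int2 : forall (y : 'I_n -> R) i, prior.-integrable setT
  (fun j => (theta F x beta prior y j * F j (x i) ^+ 2)%:E).
Hypothesis xi_sq : forall i, P.-integrable setT (EFin \o (fun w => xi i w ^+ 2)).
Variables (g : R -> R) (G : R).
Hypotheses (mg : measurable_fun setT g) (g0 : forall z, 0 <= g z)
  (gG : forall z, g z <= G) (Gbeta : 4 * G <= beta).
Hypothesis mfun_g : forall i a b,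
  (\int[lebesgue_measure]_(z in `]a, b]) (m_fun (xi i) z)%:E =
   \int[distribution P (xi i)]_(z in `]a, b]) (g z)%:E)%E.
Variables (k : nat) (pk : (0 < prior [set k])%E).

Let Y (w : Om) (i : 'I_n) := f (x i) + xi i w.
Let fh (w : Om) (i : 'I_n) := ewa F x beta prior (Y w) (x i).
Let D i w := (fh w i - f (x i)) ^+ 2.
Let V i w := gibbs_var x F prior beta (Y w) i.
Let S i w := xi i w * (fh w i - f (x i)).
Let B w := \sum_(i < n) (Y w i - F k (x i)) ^+ 2 -
  beta * ln (fine (prior [set k])).

Let I_xi i : P.-integrable setT (EFin \o xi i). Proof. exact: xi_integrable. Qed.

Let I_resid i (c : R) : P.-integrable setT (EFin \o (fun w => (c + xi i w) ^+ 2)).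
Proof.
rewrite (_ : (fun w => (c + xi i w) ^+ 2) =
    fun w => c ^+ 2 + (2 * c * xi i w + xi i w ^+ 2)); last first.
  by apply/funext => w; ring.
apply: integrableD_fun; first exact: integrable_cstP.
by apply: integrableD_fun (xi_sq i); exact: integrableZ_fun.
Qed.

Let E_resid i (c : R) : \int[P]_w ((c + xi i w) ^+ 2) =
  c ^+ 2 + \int[P]_w (xi i w ^+ 2).
Proof.
rewrite (_ : (fun w => (c + xi i w) ^+ 2) =
    fun w => c ^+ 2 + (2 * c * xi i w + xi i w ^+ 2)); last first.
  by apply/funext => w; ring.
have IZ : P.-integrable setT (EFin \o (fun w => 2 * c * xi i w)).
  exact: integrableZ_fun.
rewrite RintegralD//; [|exact: integrable_cstP|exact: integrableD_fun].
rewrite RintegralD// RintegralZl// Rintegral_cstP.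
have -> : \int[P]_w xi i w = 0.
  by rewrite /Rintegral; have := xi_mean0 i; rewrite unlock => ->.
by rewrite mulr0 add0r.
Qed.

Let mY i : measurable_fun setT (Y ^~ i).
Proof. exact: measurable_funD. Qed.

Let m_fh i : measurable_fun setT (fh ^~ i).
Proof. exact: measurable_ewa. Qed.

Let m_V i : measurable_fun setT (V i).
Proof. exact: measurable_gibbs_var. Qed.

Let m_D i : measurable_fun setT (D i).
Proof. by apply: measurable_funX; exact: measurable_funB. Qed.

Let m_S i : measurable_fun setT (S i).
Proof. by apply: measurable_funM => //; exact: measurable_funB. Qed.

Let BE w : B w = \sum_(i < n) (f (x i) - F k (x i) + xi i w) ^+ 2 -
  beta * ln (fine (prior [set k])).
Proof. by rewrite /B; congr (_ - _); apply: eq_bigr => i _; rewrite /Y addrAC. Qed.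

Let I_B : P.-integrable setT (EFin \o B).
Proof.
rewrite (_ : B = fun w => \sum_(i < n) (f (x i) - F k (x i) + xi i w) ^+ 2 -
  beta * ln (fine (prior [set k]))); last by apply/funext => w; exact: BE.
apply: integrableB_fun; last exact: integrable_cstP.
by apply: integrable_sum_fun => i; exact: I_resid.
Qed.

Let V_ge0 i w : 0 <= V i w.
Proof. exact: gibbs_var_ge0. Qed.

Let sum_le_B w : \sum_(i < n) ((Y w i - fh w i) ^+ 2 + V i w) <= B w.
Proof. exact: gibbs_variational. Qed.

(** Source of the integrability under (I): [B] is quadratic in the noise, hence integrable, and each
    nonnegative summand lies below it. *)
Let term_le_B i w : (Y w i - fh w i) ^+ 2 + V i w <= B w.
Proof.
apply: le_trans (sum_le_B w); rewrite (bigD1 i)//= lerDl.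
by apply: sumr_ge0 => j _; rewrite addr_ge0 ?sqr_ge0.
Qed.

Let I_V i : P.-integrable setT (EFin \o V i).
Proof.
apply: (integrable_dom (m_V i) I_B) => w; rewrite ger0_norm//.
by apply: le_trans (term_le_B i w); rewrite lerDr sqr_ge0.
Qed.

Let DE i w : D i w = (Y w i - fh w i) ^+ 2 - xi i w ^+ 2 + 2 * S i w.
Proof. by rewrite /D /S /Y; ring. Qed.

Let I_D i : P.-integrable setT (EFin \o D i).
Proof.
apply: (integrable_dom (m_D i) (g := fun w => 2 * B w + 2 * xi i w ^+ 2)).
  by apply: integrableD_fun; exact: integrableZ_fun.
move=> w; rewrite ger0_norm ?sqr_ge0//.
have := term_le_B i w; have := V_ge0 i w; rewrite /D /Y.
move: (B w) (V i w) (fh w i) (xi i w) (f (x i)) => b v h z c v0 H.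
(* This square is [2 (c + z - h)^2 + 2 z^2 - (h - c)^2], the slack in the bound on [D]. *)
have : 0 <= (h - c - 2 * z) ^+ 2 by exact: sqr_ge0.
nra.
Qed.

Let I_S i : P.-integrable setT (EFin \o S i).
Proof.
apply: (integrable_dom (m_S i) (g := fun w => D i w + xi i w ^+ 2)).
  exact: integrableD_fun.
move=> w; rewrite /S /D; move: (xi i w) (fh w i - f (x i)) => a b.
by rewrite ler_norml; apply/andP; split; nra.
Qed.

(** All noises but the [i]-th. [upd] puts a value [t] back in the erased slot, so that
    [phi i (rest i w)] is a function of the [i]-th noise with the others frozen. *)
Let rest i w := [the n.-tuple R of
  mktuple (fun j => if j \in ([set~ i])%SET then xi j w else 0)].

Let yrest (v : n.-tuple R) (j : 'I_n) := f (x j) + tnth v j.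

Let phi i v (t : R) := ewa F x beta prior (upd i (f (x i) + t) (yrest v)) (x i) - f (x i).
Let psi i v (t : R) := gibbs_var x F prior beta (upd i (f (x i) + t) (yrest v)) i.

Let upd_rest i w : upd i (f (x i) + xi i w) (yrest (rest i w)) = Y w.
Proof.
apply/funext => j; rewrite /upd /yrest /Y tnth_mktuple !inE.
by case: eqP => [->|].
Qed.

Let m_upd i j : measurable_fun [set: n.-tuple R * R]
  (fun vt => upd i (f (x i) + vt.2) (yrest vt.1) j).
Proof.
rewrite /upd; case: (j == i); first exact: measurable_funD.
apply: measurable_funD => //.
by apply: (measurableT_comp (measurable_tnth j)).
Qed.

Let m_phi i : measurable_fun [set: n.-tuple R * R] (fun vt => phi i vt.1 vt.2).
Proof. by apply: measurable_funB => //; apply: measurable_ewa => //; exact: m_upd. Qed.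

Let m_phi0 i : measurable_fun [set: n.-tuple R] (fun v => phi i v 0).
Proof.
have mp : measurable_fun setT (fun v : n.-tuple R => (v, 0 : R)).
  exact: measurable_fun_pair.
exact: (measurableT_comp (m_phi i) mp).
Qed.

Let m_psi i : measurable_fun [set: n.-tuple R * R] (fun vt => psi i vt.1 vt.2).
Proof. by apply: measurable_gibbs_var => //; exact: m_upd. Qed.

Let m_rest i : measurable_fun setT (rest i).
Proof.
apply: (measurable_mktuple
  (f := fun j w => if j \in ([set~ i])%SET then xi j w else 0)) => j.
by case: (j \in _).
Qed.

Let indep i : independent_pair P (rest i) (xi i).
Proof.
move=> A A' mA mA'; rewrite setIC muleC.
apply: (mutually_independent_rest (proj1 xi_iid)) => //.
by rewrite !inE eqxx.
Qed.

Let psi_ge0 i v t : 0 <= psi i v t.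
Proof. exact: gibbs_var_ge0. Qed.

Let dphi i v (t : R) : is_derive t 1 (phi i v) (2 / beta * psi i v t).
Proof. exact: is_derive_ewa_coordinate. Qed.

Let cpsi i v : continuous (fun t => 2 / beta * psi i v t).
Proof.
move=> t; apply: (@continuousM _ _ (fun=> 2 / beta)); first exact: cvg_cst.
exact: continuous_gibbs_var_coordinate.
Qed.

Let s0 : 0 <= 2 / beta. Proof. by rewrite divr_ge0// ltW. Qed.

(** Stein's inequality in the [i]-th noise for frozen others, then integrated over them. The slope
    of [phi] is [2 / beta] times the posterior variance, whence the constant. *)
Let E_increment i :
  (\int[P]_w (xi i w * (phi i (rest i w) (xi i w) - phi i (rest i w) 0))%:E <=
   (G * (2 / beta))%:E * \int[P]_w (V i w)%:E)%E.
Proof.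
pose h (vt : n.-tuple R * R) := (vt.2 * (phi i vt.1 vt.2 - phi i vt.1 0))%:E.
have mh : measurable_fun setT h.
  apply/measurable_EFinP; apply: measurable_funM => //.
  apply: measurable_funB => //.
  by apply: (measurableT_comp (m_phi0 i)).
rewrite (@ge0_integral_independent_pair _ _ _ P _ _ _ _ (rest i) (xi i) h)//; last first.
  move=> vt; rewrite lee_fin; apply: (increment_ge0 (dphi i vt.1) (@cpsi i vt.1)).
  by move=> z; rewrite mulr_ge0.
have mpsi' (c : R) : measurable_fun setT (fun vt => (c * psi i vt.1 vt.2)%:E).
  by apply/measurable_EFinP; apply: measurable_funM.
have G0 : 0 <= G by apply: le_trans (gG 0).
pose h1 (vt : n.-tuple R * R) := (G * (2 / beta) * psi i vt.1 vt.2)%:E.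
have mh1 : measurable_fun setT h1 by exact: mpsi'.
have h10 vt : (0 <= h1 vt)%E.
  by rewrite lee_fin; apply: mulr_ge0 => //; exact: mulr_ge0.
have -> : ((G * (2 / beta))%:E * \int[P]_w (V i w)%:E =
    \int[P]_w \int[P]_w' h1 (rest i w, xi i w'))%E.
  rewrite -(@ge0_integral_independent_pair _ _ _ P _ _ _ _ (rest i) (xi i) h1)//.
  rewrite -(_ : (\int[P]_w ((G * (2 / beta))%:E * (V i w)%:E))%E =
      ((G * (2 / beta))%:E * \int[P]_w (V i w)%:E)%E).
    by apply: eq_integral => w _; rewrite /h1 /= -EFinM /psi upd_rest.
  apply: ge0_integralZl.
  - exact: measurableT.
  - exact/measurable_EFinP.
  - by move=> w _; rewrite lee_fin.
  - by rewrite lee_fin; exact: mulr_ge0.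
have mint (u : n.-tuple R * R -> \bar R) : measurable_fun setT u ->
    (forall vt, 0 <= u vt)%E ->
    measurable_fun setT (fun w => (\int[P]_w' u (rest i w, xi i w'))%E).
  move=> mu u0; apply: (@measurable_fun_fubini_tonelli_F _ _ _ _ _ P
    (fun ww : Om * Om => u (rest i ww.1, xi i ww.2))) => //.
  apply: (measurableT_comp mu); apply: measurable_fun_pair.
    exact: measurableT_comp.
  exact: measurableT_comp.
have h0 vt : (0 <= h vt)%E.
  rewrite lee_fin; apply: (increment_ge0 (dphi i vt.1) (@cpsi i vt.1)).
  by move=> z; rewrite mulr_ge0.
have mpair (v : n.-tuple R) : measurable_fun setT (fun w => (v, xi i w)).
  exact: measurable_fun_pair.
apply: ge0_le_integral => //.
- by move=> w _; exact: integral_ge0.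
- exact: mint.
- by apply: mint => //; exact: mpsi'.
- move=> w _; rewrite /h /=.
  have := @stein_le _ _ _ _ (xi i) (xi_integrable i) (xi_mean0 i) g G mg g0 gG
    (mfun_g i) _ _ (dphi i (rest i w)) (@cpsi i (rest i w)).
  move=> /(_ (fun z => mulr_ge0 s0 (psi_ge0 i (rest i w) z))) /le_trans; apply.
  have m1 c : measurable_fun setT (fun w' => (c * psi i (rest i w) (xi i w'))%:E).
    exact: (measurableT_comp (mpsi' c) (mpair (rest i w))).
  rewrite -(_ : (\int[P]_w' (G%:E * (2 / beta * psi i (rest i w) (xi i w'))%:E))%E =
    (G%:E * \int[P]_w' (2 / beta * psi i (rest i w) (xi i w'))%:E)%E); last first.
    apply: ge0_integralZl.
    - exact: measurableT.
    - exact: m1.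
    - by move=> w' _; rewrite lee_fin mulr_ge0.
    - by rewrite lee_fin.
  rewrite le_eqVlt; apply/orP; left; apply/eqP.
  by apply: eq_integral => w' _; rewrite -EFinM mulrA.
Qed.

Let E_S i : \int[P]_w S i w <= 2^-1 * \int[P]_w V i w.
Proof.
pose h0 w := xi i w * (phi i (rest i w) (xi i w) - phi i (rest i w) 0).
have h00 w : 0 <= h0 w.
  apply: (increment_ge0 (dphi i _) (@cpsi i _)).
  by move=> z; rewrite mulr_ge0.
have mrx : measurable_fun setT (fun w => (rest i w, xi i w)).
  exact: measurable_fun_pair.
have mh0 : measurable_fun setT h0.
  apply: measurable_funM => //; apply: measurable_funB.
    by apply: (measurableT_comp (m_phi i) mrx).
  exact: (measurableT_comp (m_phi0 i)).
have Ih0 : P.-integrable setT (EFin \o h0).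
  apply: integrable_ge0_lty => //; apply: le_lt_trans (E_increment i) _.
  by rewrite -EFin_Rintegral// -EFinM ltry.
(* What the increment leaves out is [xi i] times a function of the other noises, of mean zero. *)
have SE w : S i w = h0 w + xi i w * phi i (rest i w) 0.
  by rewrite /h0 -mulrDr subrK /S /phi upd_rest.
have Ic : P.-integrable setT (EFin \o (fun w => xi i w * phi i (rest i w) 0)).
  rewrite (_ : (fun w => xi i w * _) = fun w => S i w - h0 w).
    exact: integrableB_fun.
  by apply/funext => w; rewrite SE addrC addKr.
under eq_Rintegral do rewrite SE.
rewrite RintegralD//.
have -> : \int[P]_w (xi i w * phi i (rest i w) 0) = 0.
  rewrite /Rintegral (@integral_centered_independent _ _ _ P _ _ (xi i) (rest i)
    (fun v => phi i v 0))//.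
  - by move=> A A' mA mA'; rewrite setIC muleC; exact: indep.
  - by have := xi_mean0 i; rewrite unlock.
rewrite addr0 -lee_fin EFin_Rintegral//; apply: le_trans (E_increment i) _.
rewrite -EFin_Rintegral// -EFinM lee_fin ler_wpM2r//.
  by apply: Rintegral_ge0 => w _; exact: V_ge0.
(* [4 * G <= beta] is exactly [G * (2 / beta) <= 1 / 2]: the threshold on [beta]. *)
rewrite mulrA ler_pdivrMr// [leRHS]mulrC ler_pdivlMr//.
by move: Gbeta => ?; lra.
Qed.

Lemma gibbs_risk_I :
  ('E_P[fun w => sqdist_n (ewa F x beta prior (Y w) \o x) (f \o x)] <=
   (sqdist_n (F k \o x) (f \o x) - beta * ln (fine (prior [set k])) / n%:R)%:E)%E.
Proof.
rewrite unlock (_ : (fun w => _) = fun w => (n%:R^-1 * \sum_(i < n) D i w)%:E)//.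
have ID := integrable_sum_fun I_D.
rewrite -EFin_Rintegral; last exact: integrableZ_fun.
rewrite lee_fin RintegralZl// Rintegral_sum//.
have n0 : 0 < n%:R :> R by rewrite ltr0n.
rewrite -(ler_pM2l n0) mulVKf ?gt_eqF// mulrBr nsqdistE// mulrCA divff ?gt_eqF// mulr1.
(* By [DE] this is the summand [(Y - fh)^2 + V] of the variational inequality, arranged so that
   [2 * S] is charged to [V] in expectation; the noise variances then cancel against those in
   [B]. *)
pose Tm i w := D i w + (V i w + (xi i w ^+ 2 - 2 * S i w)).
have I2S i : P.-integrable setT (EFin \o (fun w => 2 * S i w)).
  exact: integrableZ_fun.
have I3 i : P.-integrable setT (EFin \o (fun w => xi i w ^+ 2 - 2 * S i w)).
  exact: integrableB_fun.
have I4 i : P.-integrable setT (EFin \o (fun w => V i w + (xi i w ^+ 2 - 2 * S i w))).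
  exact: integrableD_fun.
have IT i : P.-integrable setT (EFin \o Tm i) by exact: integrableD_fun.
have ET i : \int[P]_w D i w + \int[P]_w (xi i w ^+ 2) <= \int[P]_w Tm i w.
  rewrite /Tm RintegralD// RintegralD// RintegralB// RintegralZl//.
  have := E_S i; lra.
have : \int[P]_w (\sum_(i < n) Tm i w) <= \int[P]_w B w.
  apply: le_Rintegral => //; first exact: integrable_sum_fun.
  move=> w _; apply: le_trans (sum_le_B w); apply: ler_sum => i _.
  by rewrite /Tm DE; lra.
rewrite Rintegral_sum//.
under [X in _ <= X]eq_Rintegral do rewrite BE.
rewrite RintegralB//; last 2 first.
- by apply: integrable_sum_fun => i; exact: I_resid.
- exact: integrable_cstP.
rewrite Rintegral_sum//.
under [X in _ <= X - _]eq_bigr do rewrite E_resid.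
rewrite Rintegral_cstP big_split/= => H.
have : \sum_(i < n) (\int[P]_w D i w + \int[P]_w (xi i w ^+ 2)) <=
    \sum_(i < n) \int[P]_w Tm i w by apply: ler_sum => i _; exact: ET.
rewrite big_split/= => H'.
have -> : \sum_(i < n) ((F k \o x) i - (f \o x) i) ^+ 2 =
    \sum_(i < n) (f (x i) - F k (x i)) ^+ 2.
  by apply: eq_bigr => i _; rewrite /= -sqrrN opprB.
by lra.
Qed.

End case_I.

(** * Concavity over mixtures of atoms *)

Section mnormalize.
Context d (T : measurableType d) (R : realType).
Variables (m : {measure set T -> \bar R}) (Q : probability T R).

Lemma mnormalizeE (c : R) A : c != 0 -> m setT = c%:E ->
  mnormalize m Q A = (c^-1%:E * m A)%E.
Proof. by move=> c0 mc; rewrite /mnormalize mc/= orbF eqe (negbTE c0) muleC. Qed.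

Lemma mnormalize0 A : m setT = 0%E -> mnormalize m Q A = Q A.
Proof. by move=> m0; rewrite /mnormalize m0 eqxx. Qed.

End mnormalize.

Section density_probability.
Context d (T : measurableType d) (R : realType) (mu : {measure set T -> \bar R}).
Variable g : T -> R.
Hypotheses (mg : measurable_fun setT g) (g0 : forall t, 0 <= g t).
Hypothesis g1 : (\int[mu]_t (g t)%:E = 1)%E.

Lemma density_probability : exists Q : probability T R,
  (forall A, measurable A -> Q A = \int[mu]_(t in A) (g t)%:E)%E /\
  (forall h : T -> \bar R, measurable_fun setT h -> (forall t, 0 <= h t)%E ->
    \int[Q]_t h t = \int[mu]_t (h t * (g t)%:E))%E.
Proof.
have nu1 : mdensity mu mg g0 setT = 1%E by exact: g1.
(* The fallback [dirac point] is for a mass zero or infinite; the mass here is one. *)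
pose Q : probability T R := mnormalize (mdensity mu mg g0) (dirac point).
have QE A : Q A = mdensity mu mg g0 A.
  transitivity (1^-1%:E * mdensity mu mg g0 A)%E; last by rewrite invr1 mul1e.
  exact: (mnormalizeE _ _ (oner_neq0 R) nu1).
exists Q; split => [A mA|h mh h0]; first exact: QE.
rewrite -(ge0_integral_density mu mg g0)//; apply: eq_measure_integral => A mA _.
exact: QE.
Qed.

End density_probability.

Section concave_atoms.
Context (R : realType) (X : Type) (n : nat) (x : 'I_n -> X) (F : nat -> X -> R).
Implicit Types mu : probability nat R.

Lemma P'L_dirac j : P'L F x (dirac j : probability nat R).
Proof.
move=> i; apply/integrableP; split => //.
by rewrite integral_dirac//= diracT mul1e ltry.
Qed.

Lemma P'L_le mu mu' (C : R) : 0 <= C ->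
  (forall j, mu' [set j] <= C%:E * mu [set j])%E -> P'L F x mu -> P'L F x mu'.
Proof.
move=> C0 le Pmu i; apply/integrableP; split => //.
have /integrableP[_] := Pmu i; rewrite !ge0_integral_nat// => oo.
apply: (@le_lt_trans _ _ (C%:E * \sum_(k <oo) (`|(F k (x i))%:E| * mu [set k]))%E).
  rewrite -nneseriesZl//; last by move=> k _; rewrite mule_ge0.
  apply: lee_nneseries => k _; first by rewrite mule_ge0.
  by rewrite muleCA; apply: lee_wpmul2l => //; exact: le.
exact: lte_mul_pinfty.
Qed.

(* Splitting off the atoms one by one: [mu] is a mixture of [dirac N] and of
   [mu] conditioned on the complement of [N]. *)
Lemma concave_sum_atoms (psi : probability nat R -> R) :
  concave_on_P'L F x psi -> (forall mu, P'L F x mu -> 0 <= psi mu) ->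
  forall N mu, P'L F x mu ->
  \sum_(j < N) fine (mu [set val j]) * psi (dirac (val j)) <= psi mu.
Proof.
move=> cpsi psi0; elim=> [|N IH] mu Pmu.
  (* What remains once the atoms are split off contributes at least zero. *)
  by rewrite big_ord0; exact: psi0.
have mN : measurable (~` [set N] : set nat) by [].
(* If [mu] is concentrated on [N], the restriction has mass zero and [nu] falls back on [dirac N],
   which still lies in [P'L]. *)
pose nu : probability nat R := mnormalize (mrestr mu mN) (dirac N).
pose p := fine (mu [set N]).
have muE A : mu A = (fine (mu A))%:E by rewrite fineK// fin_num_measure.
have p0 : 0 <= p by rewrite fine_ge0.
have p1 : p <= 1.
  by rewrite -lee_fin -muE; exact: probability_le1.
have restrE A : mrestr mu mN A = mu (A `&` ~` [set N]) by [].
have massE : mrestr mu mN setT = (1 - p)%:E.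
  by rewrite restrE setTI (probability_setC mu)// muE.
have nuE A : ((1 - p)%:E * nu A = mu (A `&` ~` [set N]))%E.
  have [p10|p10] := eqVneq (1 - p) 0.
    rewrite p10 mul0e; apply/esym/eqP; rewrite -measure_le0.
    have <- : mrestr mu mN setT = 0%E by rewrite massE p10.
    rewrite restrE; apply: le_measure; rewrite ?inE//.
    by apply: setSI.
  have -> : nu A = ((1 - p)^-1%:E * mrestr mu mN A)%E.
    exact: (mnormalizeE _ _ p10 massE).
  by rewrite muleA -EFinM divff// mul1e.
have Pnu : P'L F x nu.
  have [p10|p10] := eqVneq (1 - p) 0.
    apply: (P'L_le (mu := dirac N) (C := 1)) => //; last exact: P'L_dirac.
    move=> j; rewrite mul1e le_eqVlt; apply/orP; left; apply/eqP.
    by apply: mnormalize0; rewrite -[0%E]/(0 : R)%:E -p10 -massE.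
  have q0 : 0 < 1 - p by rewrite lt_neqAle eq_sym p10/= subr_ge0.
  apply: (P'L_le (mu := mu) (C := (1 - p)^-1)) => //; first by rewrite invr_ge0 ltW.
  move=> j; rewrite -(@lee_pmul2l _ (1 - p)%:E)// ?lte_fin// nuE.
  rewrite muleA -EFinM divff// mul1e; by apply: le_measure; rewrite ?inE.
have mix : is_mixture p (dirac N) nu mu.
  move=> A _; rewrite nuE.
  have -> : (p%:E * (dirac N : probability nat R) A = mu (A `&` [set N]))%E.
    rewrite /= diracE; have [/set_mem AN|/negP AN] := boolP (N \in A).
      rewrite mule1 /p -muE; congr (mu _); apply/seteqP; split => [_ -> //|k []//].
    rewrite mule0 (_ : A `&` [set N] = set0) ?measure0//.
    by apply/seteqP; split => // k [Ak kN]; apply: AN; rewrite -kN; exact: mem_set.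
  rewrite -measureU//.
    by rewrite -setIUr setUv setIT.
  by apply/seteqP; split => // k [[_ kN] [_]] /=.
apply: le_trans (cpsi _ _ _ _ _ (P'L_dirac N) Pnu Pmu mix); last by rewrite p0.
rewrite big_ord_recr/= addrC lerD2l.
have := IH _ Pnu; move=> /(ler_wpM2l (_ : 0 <= 1 - p)).
rewrite subr_ge0 => /(_ p1); apply: le_trans.
rewrite mulr_sumr; apply: ler_sum => j _; rewrite mulrA ler_wpM2r//.
  by apply: psi0; exact: P'L_dirac.
have jN : [set val j] `&` [set~ N] = [set val j].
  apply/seteqP; split => [k []//|k ->]; split => //= jN.
  by have := ltn_ord j; rewrite /= jN ltnn.
rewrite -lee_fin EFinM ![(fine _)%:E]fineK ?fin_num_measure//.
by rewrite nuE jN.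
Qed.

End concave_atoms.

(** * The drift argument under (II) *)

Section drift.
Context d (T : measurableType d) (R : realType) (P : probability T R).
Context dE (E : measurableType dE) dZ (EZ : measurableType dZ).
Variables (V : T -> E) (Z : T -> EZ) (c : E * EZ -> E) (D A : E -> R) (p b : R).
Hypotheses (mV : measurable_fun setT V) (mZ : measurable_fun setT Z)
  (VZ : independent_pair P V Z) (mc : measurable_fun setT c)
  (mD : measurable_fun setT D) (mA : measurable_fun setT A)
  (D0 : forall v, 0 <= D v) (A0 : forall v, 0 <= A v) (p1 : 1 <= p) (b0 : 0 <= b).
(** The law of [V] is stationary for the Markov kernel that sends [v] to the law of [c (v, Z)], and
    [drift] is a Foster-Lyapunov condition with Lyapunov function [D]; [A] is the rate to be bounded
    in mean. *)
Hypothesis cV : same_law P (fun w => c (V w, Z w)) P V.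
Hypothesis drift : forall v,
  (\int[P]_w (D (c (v, Z w)))%:E <= ((D v - A v + b) / p)%:E)%E.

Let p0 : 0 < p. Proof. exact: lt_le_trans p1. Qed.
Let B v := (D v - A v + b) / p.

Let B0 v : 0 <= B v.
Proof.
rewrite -lee_fin; apply: le_trans (drift v).
by apply: integral_ge0 => w _; rewrite lee_fin.
Qed.

Let tr (K : nat) (r : R) := Num.min r K%:R.

Let tr_ge0 K r : 0 <= r -> 0 <= tr K r.
Proof. by move=> r0; rewrite /tr le_min r0/=. Qed.

Let m_tr K dU (U : measurableType dU) (u : U -> R) :
  measurable_fun setT u -> measurable_fun setT (fun w => (tr K (u w))%:E).
Proof. by move=> mu; apply/measurable_EFinP; exact: measurable_minr. Qed.

Let m_B : measurable_fun setT B.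
Proof.
by apply: measurable_funM => //; apply: measurable_funD => //; exact: measurable_funB.
Qed.

(** By stationarity the left-hand side is the mean of the truncated [D] after one transition.
    Truncation is concave: given [V], that mean is at most [B] and at most [K]. *)
Let tr_drift K : (\int[P]_w (tr K (D (V w)))%:E <= \int[P]_w (tr K (B (V w)))%:E)%E.
Proof.
have mcVZ : measurable_fun setT (fun w => c (V w, Z w)).
  by apply: (measurableT_comp mc); exact: measurable_fun_pair.
rewrite -(same_law_integral (u := fun v => (tr K (D v))%:E) mcVZ mV cV)//; last 2 first.
- exact: m_tr.
- by move=> v; rewrite lee_fin tr_ge0.
have mDc : measurable_fun setT (D \o c) := measurableT_comp mD mc.
rewrite (@ge0_integral_independent_pair _ _ _ P _ _ _ _ V Z
  (fun z => (tr K (D (c z)))%:E))//; last 2 first.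
- exact: (m_tr K mDc).
- by move=> z; rewrite lee_fin tr_ge0.
have mDcv v : measurable_fun setT (fun w => D (c (v, Z w))).
  by apply: (measurableT_comp mDc); exact: measurable_fun_pair.
apply: ge0_le_integral => //.
- by move=> w _; apply: integral_ge0 => w' _; rewrite lee_fin tr_ge0.
- apply: (@measurable_fun_fubini_tonelli_F _ _ _ _ _ P
    (fun ww : T * T => (tr K (D (c (V ww.1, Z ww.2))))%:E)).
    apply: m_tr; apply: (measurableT_comp mDc).
    by apply: measurable_fun_pair; exact: measurableT_comp.
  by move=> ww; rewrite lee_fin tr_ge0.
- by apply: m_tr; exact: measurableT_comp.
- move=> w _; rewrite {2}/tr EFin_min le_min; apply/andP; split.
    apply: le_trans (drift (V w)); apply: ge0_le_integral => //.
    + by move=> w' _; rewrite lee_fin tr_ge0.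
    + exact: m_tr.
    + exact/measurable_EFinP.
    + by move=> w' _; rewrite lee_fin /tr ge_min lexx.
  apply: (@le_trans _ _ (\int[P]_w' (cst K%:R%:E w'))%E).
    apply: ge0_le_integral => //.
    + by move=> w' _; rewrite lee_fin tr_ge0.
    + exact: m_tr.
    + by move=> w' _; rewrite lee_fin /tr ge_min lexx orbT.
  by rewrite integral_cst// [X in (_ * X)%E](@probability_setT _ _ _ P) mule1.
Qed.

Let J (K : nat) v := if D v <= K%:R then A v else 0.

Let J0 K v : 0 <= J K v.
Proof. by rewrite /J; case: ifP. Qed.

Let m_J K : measurable_fun setT (J K).
Proof. by apply: measurable_fun_ifT => //; exact: measurable_fun_ler. Qed.

(** Where [D <= K], [B + A / p = (D + b) / p <= D + b / p] since [p >= 1] and [D >= 0]; elsewhere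
    [J] vanishes and the truncated [D] equals [K]. *)
Let tr_le K v : tr K (B v) + J K v / p <= tr K (D v) + b / p.
Proof.
have bp : 0 <= b / p by rewrite divr_ge0// ltW.
rewrite /J /tr; case: ifPn => DK; last rewrite -ltNge in DK.
  rewrite (min_l DK); apply: (@le_trans _ _ (B v + A v / p)).
    by rewrite lerD2r ge_min lexx.
  have -> : B v + A v / p = (D v + b) / p by rewrite /B; ring.
  by rewrite mulrDl lerD2r ler_pdivrMr// ler_peMr.
rewrite mul0r addr0 (min_r (ltW DK)).
by apply: (@le_trans _ _ K%:R); [rewrite ge_min lexx orbT|rewrite lerDl].
Qed.

Let int_J K : (\int[P]_w (J K (V w))%:E <= b%:E)%E.
Proof.
have mJp : measurable_fun setT (fun w => (J K (V w) / p)%:E).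
  apply/measurable_EFinP; apply: measurable_funM => //; exact: measurableT_comp.
have mtB : measurable_fun setT (fun w => (tr K (B (V w)))%:E).
  by apply: m_tr; exact: measurableT_comp.
have mtD : measurable_fun setT (fun w => (tr K (D (V w)))%:E).
  by apply: m_tr; exact: measurableT_comp.
have Jp0 w : (0 <= (J K (V w) / p)%:E)%E by rewrite lee_fin divr_ge0// ltW.
have tB0 w : (0 <= (tr K (B (V w)))%:E)%E by rewrite lee_fin tr_ge0.
have tD0 w : (0 <= (tr K (D (V w)))%:E)%E by rewrite lee_fin tr_ge0.
have bp : 0 <= b / p by rewrite divr_ge0// ltW.
(* Thanks to the truncation this integral is finite and can be cancelled from both sides. *)
have finB : (\int[P]_w (tr K (B (V w)))%:E)%E \is a fin_num.
  rewrite ge0_fin_numE; last exact: integral_ge0.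
  apply: (@le_lt_trans _ _ (\int[P]_w (cst K%:R%:E w))%E).
    apply: ge0_le_integral => //.
    by move=> w _; rewrite lee_fin /tr ge_min lexx orbT.
  by rewrite integral_cst// [X in (_ * X)%E](@probability_setT _ _ _ P) mule1 ltry.
have : (\int[P]_w ((tr K (B (V w)))%:E + (J K (V w) / p)%:E) <=
    \int[P]_w ((tr K (D (V w)))%:E + (cst (b / p)%:E w)))%E.
  apply: ge0_le_integral => //.
  - by move=> w _; rewrite adde_ge0.
  - exact: emeasurable_funD.
  - exact: emeasurable_funD.
  - by move=> w _; rewrite -!EFinD lee_fin tr_le.
rewrite ge0_integralD// ge0_integralD// integral_cst//.
rewrite [X in (_ + _ * X)%E](@probability_setT _ _ _ P) mule1.
move=> /le_trans/(_ (leeD2r _ (tr_drift K))).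
rewrite leeD2lE// => H.
have E1 w : (J K (V w))%:E = (p%:E * (J K (V w) / p)%:E)%E.
  by rewrite -EFinM mulrC divfK// gt_eqF.
under eq_integral do rewrite E1.
rewrite ge0_integralZl//; last by rewrite lee_fin ltW.
apply: (@le_trans _ _ (p%:E * (b / p)%:E)%E).
  by apply: lee_wpmul2l => //; rewrite lee_fin ltW.
by rewrite -EFinM mulrC divfK// gt_eqF.
Qed.

(* [D (V w)] need not be integrable, hence the truncations [tr K]. *)
Lemma drift_bound : (\int[P]_w (A (V w))%:E <= b%:E)%E.
Proof.
have mJ K : measurable_fun setT (fun w => (J K (V w))%:E).
  by apply/measurable_EFinP; exact: measurableT_comp.
have JA w : (J K (V w))%:E @[K --> \oo] --> (A (V w))%:E.
  apply: cvg_near_cst; exists (Num.truncn (D (V w))).+1 => // K /= DK.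
  congr EFin; rewrite /J ifT//; apply/ltW/(lt_le_trans (truncnS_gt _)).
  by rewrite ler_nat.
have := @cvg_monotone_convergence _ _ _ P setT measurableT
  (fun K w => (J K (V w))%:E) mJ.
move=> /(_ (fun K w _ => _)) H.
have {}H : (\int[P]_w (J K (V w))%:E)%E @[K --> \oo] --> (\int[P]_w (A (V w))%:E)%E.
  rewrite (_ : (\int[P]_w (A (V w))%:E)%E =
      (\int[P]_w limn (fun K => (J K (V w))%:E))%E); last first.
    by apply: eq_integral => w _; apply/esym/cvg_lim.
  apply: H => [K w|w _ K K' KK'].
    by rewrite lee_fin.
  rewrite lee_fin /J; case: ifPn => // DK; case: ifPn => //.
  by move=> /negP; case; apply: (le_trans DK); rewrite ler_nat.
rewrite -(cvg_lim _ H)//; apply: lime_le; first by apply/cvg_ex; eexists; exact: H.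
by apply: nearW => K; exact: int_J.
Qed.

End drift.

(** * Law of the rescaled perturbed noise *)

Section sum_law.
Context (R : realType) (n : nat) (i1 : 'I_n).
Context d (T : measurableType d) (P : probability T R).
Variables (eta zeta : 'I_n -> {RV P >-> R}) (c : R).
Hypotheses (eta_iid : iid eta) (zeta_iid : iid zeta) (c0 : c != 0).

Definition tuple_of_rv (X : 'I_n -> {RV P >-> R}) (w : T) : n.-tuple R :=
  [the n.-tuple R of mktuple (fun i => X i w)].

Hypothesis indep : independent_pair P (tuple_of_rv zeta) (tuple_of_rv eta).
Hypothesis law1 : same_law P (fun w => eta i1 w + zeta i1 w) P (fun w => c * eta i1 w).

Lemma measurable_tuple_of_rv X : measurable_fun setT (tuple_of_rv X).
Proof. exact: measurable_mktuple. Qed.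

Lemma independent_pair_sym d1 d2 (E1 : measurableType d1) (E2 : measurableType d2)
    (X : T -> E1) (Y : T -> E2) : independent_pair P X Y -> independent_pair P Y X.
Proof. by move=> XY A B mA mB; rewrite setIC muleC; exact: XY. Qed.

Let indep' : independent_pair P (tuple_of_rv eta) (tuple_of_rv zeta).
Proof. exact: independent_pair_sym. Qed.

Let indep1 : independent_pair P (eta i1) (zeta i1).
Proof.
move=> A B mA mB.
have mt (C : set R) : measurable C -> measurable [set v : n.-tuple R | C (tnth v i1)].
  by move=> mC; rewrite -[X in measurable X]setTI; exact: measurable_tnth.
have E X C : tuple_of_rv X @^-1` [set v | C (tnth v i1)] = X i1 @^-1` C.
  by apply/funext => w; rewrite /= tnth_mktuple.
by have := indep' (mt _ mA) (mt _ mB); rewrite !E.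
Qed.

Let scaled_sum (A : set R) (r z : R) : \bar R := (\1_A ((r + z) / c))%:E.

Let scaled_sum_ge0 A r z : (0 <= scaled_sum A r z)%E.
Proof. by rewrite lee_fin. Qed.

Let m_scaled_sum A dU (U : measurableType dU) (f g : U -> R) : measurable A ->
  measurable_fun setT f -> measurable_fun setT g ->
  measurable_fun setT (fun w => scaled_sum A (f w) (g w)).
Proof.
move=> mA mf mg; apply/measurable_EFinP.
apply: (measurableT_comp (measurable_indic mA)).
by apply: measurable_funM => //; exact: measurable_funD.
Qed.

(** [law1] concerns the index [i1] and a single sample point. Equality of laws moves [i] to [i1],
    independence merges the two sample points, and [law1] gives the law of the rescaled sum. *)
Let marginal A i : measurable A ->
  (\int[P]_w \int[P]_w' scaled_sum A (eta i w) (zeta i w') = P (eta i @^-1` A))%E.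
Proof.
move=> mA.
pose B := [set r : R | A (r / c)].
have mB : measurable B.
  have mf : measurable_fun setT (fun r : R => r / c) by exact: measurable_funM.
  by rewrite -[X in measurable X]setTI; exact: (mf measurableT A mA).
transitivity (\int[P]_w \int[P]_w' scaled_sum A (eta i1 w) (zeta i1 w'))%E.
  transitivity (\int[P]_w \int[P]_w' scaled_sum A (eta i w) (zeta i1 w'))%E.
    apply: eq_integral => w _.
    apply: (same_law_integral (u := scaled_sum A (eta i w))) => //.
      exact: (proj2 zeta_iid).
    exact: m_scaled_sum.
  apply: (same_law_integral
    (u := fun r => (\int[P]_w' scaled_sum A r (zeta i1 w'))%E)) => //.
  - exact: (proj2 eta_iid).
  - apply: (@measurable_fun_fubini_tonelli_F _ _ _ _ _ P
      (fun rw : R * T => scaled_sum A rw.1 (zeta i1 rw.2))) => //.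
    by apply: m_scaled_sum => //; exact: measurableT_comp.
  - by move=> r; exact: integral_ge0.
rewrite -(@ge0_integral_independent_pair _ _ _ P _ _ _ _ (eta i1) (zeta i1)
  (fun z => scaled_sum A z.1 z.2))//; last exact: m_scaled_sum.
transitivity (P ((fun w => eta i1 w + zeta i1 w) @^-1` B)).
  have mf : measurable_fun setT (fun w => eta i1 w + zeta i1 w).
    exact: measurable_funD.
  have mS : measurable ((fun w => eta i1 w + zeta i1 w) @^-1` B).
    by rewrite -[X in measurable X]setTI; exact: (mf measurableT B mB).
  transitivity (\int[P]_w (\1_((fun w => eta i1 w + zeta i1 w) @^-1` B) w)%:E)%E.
    by apply: eq_integral => w _; rewrite /scaled_sum !indicE.
  by rewrite integral_indic// setIT.
rewrite law1// (_ : _ @^-1` B = eta i1 @^-1` A); last first.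
  by apply/funext => w; rewrite /B /= mulrC mulKf.
by rewrite (proj2 eta_iid i i1).
Qed.

(** The laws are compared on rectangles. The probability of a rectangle is the mean of a product of
    [scaled_sum] terms, which factors over [zeta] for fixed [eta], then over [eta], down to
    [marginal]. *)
Lemma scaled_sum_same_law : same_law P
  (fun w => [the n.-tuple R of mktuple (fun i => (eta i w + zeta i w) / c)])
  P (tuple_of_rv eta).
Proof.
set V' := (fun w => _).
have mV' : measurable_fun setT V'.
  apply: (measurable_mktuple (f := fun i w => (eta i w + zeta i w) / c)) => i.
  by apply: measurable_funM => //; exact: measurable_funD.
have mV := measurable_tuple_of_rv eta.
pose X' : {RV P >-> n.-tuple R} := HB.pack V' (isMeasurableFun.Build _ _ _ _ _ mV').
pose X : {RV P >-> n.-tuple R} :=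
  HB.pack (tuple_of_rv eta) (isMeasurableFun.Build _ _ _ _ _ mV).
apply: (tuple_measure_unique (m1 := distribution P X') (m2 := distribution P X)).
  exact: (le_lt_trans (probability_le1 (distribution P X') measurableT) (ltry 1)).
move=> A mA.
have EX : P (tuple_of_rv eta @^-1` rectangle A) = (\prod_(i < n) P (eta i @^-1` A i))%E.
  have := (proj1 eta_iid) [set: 'I_n]%SET A (fun i _ => mA i).
  under [X in _ = X -> _]eq_bigl do rewrite inE.
  move=> <-; congr (P _); apply/seteqP; split => w /= H i.
    by move=> _; have := H i; rewrite tnth_mktuple.
  by rewrite tnth_mktuple; apply: H => /=; rewrite inE.
have EX' : P (V' @^-1` rectangle A) =
    (\int[P]_w \prod_(i < n) scaled_sum (A i) (eta i w) (zeta i w))%E.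
  have mS : measurable (V' @^-1` rectangle A).
    rewrite -[X in measurable X]setTI; apply: (mV' measurableT).
    exact: measurable_rectangle.
  transitivity (\int[P]_w (\1_(V' @^-1` rectangle A) w)%:E)%E.
    by rewrite integral_indic// setIT.
  apply: eq_integral => w _.
  rewrite indicE; have [/set_mem H|/negP H] := boolP (w \in _).
    rewrite big1// => i _; rewrite /scaled_sum indicE mem_set//.
    by have := H i; rewrite /V' tnth_mktuple.
  have [i Hi] : exists i, ~ A i ((eta i w + zeta i w) / c).
    apply/existsNP => Hall; apply: H; apply: mem_set => i /=.
    by rewrite /V' tnth_mktuple.
  by rewrite (bigD1 i)//= /scaled_sum indicE memNset// mul0e.
pose h (vz : n.-tuple R * n.-tuple R) : \bar R :=
  (\prod_(i < n) \1_(A i) ((tnth vz.1 i + tnth vz.2 i) / c))%:E.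
have hE w w' : h (tuple_of_rv eta w, tuple_of_rv zeta w') =
    (\prod_(i < n) scaled_sum (A i) (eta i w) (zeta i w'))%E.
  by rewrite /h -prodEFin; apply: eq_bigr => i _; rewrite /= !tnth_mktuple.
have mh : measurable_fun setT h.
  apply/measurable_EFinP; apply: measurable_prod => i _.
  apply: (measurableT_comp (measurable_indic (mA i))).
  apply: measurable_funM => //; apply: measurable_funD.
    by apply: (measurableT_comp (measurable_tnth i)).
  by apply: (measurableT_comp (measurable_tnth i)).
have h0 vz : (0 <= h vz)%E by rewrite lee_fin; apply: prodr_ge0 => i _.
apply: (etrans EX'); apply: etrans (esym EX).
transitivity (\int[P]_w h (tuple_of_rv eta w, tuple_of_rv zeta w))%E.
  by apply: eq_integral => w _; rewrite hE.
rewrite (ge0_integral_independent_pair (measurable_tuple_of_rv eta)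
  (measurable_tuple_of_rv zeta) indep' mh h0).
pose u i r := (\int[P]_w' scaled_sum (A i) r (zeta i w'))%E.
transitivity (\int[P]_w \prod_(i < n) u i (eta i w))%E.
  apply: eq_integral => w _; under eq_integral do rewrite hE.
  apply: (expectation_prod_independent
    (u := fun i z => scaled_sum (A i) (eta i w) z) (proj1 zeta_iid)) => // i.
  exact: m_scaled_sum.
rewrite (expectation_prod_independent (proj1 eta_iid)).
- by apply: eq_bigr => i _; exact: marginal.
- move=> i; apply: (@measurable_fun_fubini_tonelli_F _ _ _ _ _ P
      (fun rw : R * T => scaled_sum (A i) rw.1 (zeta i rw.2))) => //.
  by apply: m_scaled_sum => //; exact: measurableT_comp.
- by move=> i r; exact: integral_ge0.
Qed.

End sum_law.

(** Bernoulli's inequality [u^(1 + e) >= 1 + (1 + e) (u - 1)] at [u = expR s]. *)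
Lemma expR_ge_tangent (R : realType) (e s : R) : 0 <= e ->
  1 + (1 + e) * (expR s - 1) <= expR ((1 + e) * s).
Proof.
move=> e0; rewrite (_ : (1 + e) * s = s + e * s) ?expRD; last by ring.
have H1 := expR_ge1Dx (e * s); have H2 := expR_ge1Dx (- s).
have s0 := expR_gt0 s; rewrite expRN in H2.
have H3 : expR s * (1 - s) <= 1.
  by rewrite -[leRHS](mulfV (lt0r_neq0 s0)) ler_pM2l.
have : expR s * (1 + e * s) <= expR s * expR (e * s) by rewrite ler_pM2l.
have : 0 <= e * (1 - expR s * (1 - s)) by rewrite mulr_ge0// subr_ge0.
lra.
Qed.

(** * Risk bound under (II) *)

Section case_II.
Context (R : realType) (X : Type) (n : nat) (n_gt0 : (0 < n)%N).
Variables (x : 'I_n -> X) (f : X -> R) (F : nat -> X -> R).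
Variables (prior : probability nat R) (beta : R) (beta_gt0 : 0 < beta).
Hypothesis int1 : forall (y : 'I_n -> R) i, prior.-integrable setT
  (fun j => (theta F x beta prior y j * F j (x i))%:E).
Implicit Types (v z : n.-tuple R) (i : 'I_n) (j k : nat).

Let Y v i := f (x i) + tnth v i.
Let fh v i := ewa F x beta prior (Y v) (x i).
Let th v j := theta F x beta prior (Y v) j.
Let sq j := sqdist_n (F j \o x) (f \o x).
Let loss v := sqdist_n (fh v) (f \o x).
Let q : R := 1 + n%:R^-1.

(** This is the sum of squares [|Y - f_j|^2] minus [|v|^2]; what is left is affine in [v], as the
    scaling identity [h_c] requires. *)
Let h j v := \sum_(i < n)
  ((f (x i) - F j (x i)) ^+ 2 + 2 * tnth v i * (f (x i) - F j (x i))).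

(* The Gibbs mass without the factor [exp (- |v|^2 / beta)] common to all [j]. *)
Let W v := \int[prior]_j expR (- h j v / beta).

Let n0 : 0 < n%:R :> R. Proof. by rewrite ltr0n. Qed.

Let q1 : 1 <= q. Proof. by rewrite lerDl invr_ge0 ltW. Qed.

Let q0 : 0 < q. Proof. exact: lt_le_trans q1. Qed.

Let hE j v : \sum_(i < n) (Y v i - F j (x i)) ^+ 2 = h j v + \sum_(i < n) tnth v i ^+ 2.
Proof. by rewrite /h -big_split; apply: eq_bigr => i _; rewrite /Y /=; ring. Qed.

Let int_h (r : R) v : 0 <= r ->
  prior.-integrable setT (EFin \o (fun j => expR (- (r * h j v) / beta))).
Proof.
(* By [hE], [h j v] is at least minus the squared norm of [v], so a constant dominates. *)
move=> r0; apply: (integrable_dom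
  (g := fun=> expR (r * (\sum_(i < n) tnth v i ^+ 2) / beta))) => //.
  exact: integrable_cstP.
move=> j; rewrite ger0_norm ?expR_ge0// ler_expR ler_pM2r ?invr_gt0//.
rewrite -mulrN ler_wpM2l// -subr_ge0 opprK addrC -hE.
by apply: sumr_ge0 => i _; exact: sqr_ge0.
Qed.

Let int_h1 v : prior.-integrable setT (EFin \o (fun j => expR (- h j v / beta))).
Proof. by have := int_h v (@ler01 R); under eq_fun do rewrite mul1r. Qed.

Let W_gt0 v : 0 < W v.
Proof. by apply: Rintegral_gt0 => // j; exact: expR_gt0. Qed.

Let gibbs_weightE v j : gibbs_weight x F beta (Y v) j =
  expR (- (\sum_(i < n) tnth v i ^+ 2) / beta) * expR (- h j v / beta).
Proof.
by rewrite /gibbs_weight nsqdistE// hE -expRD; congr expR; ring.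
Qed.

Let thE v j : th v j = expR (- h j v / beta) / W v.
Proof.
rewrite /th thetaE /gibbs_mass; under eq_Rintegral do rewrite gibbs_weightE.
rewrite RintegralZl// gibbs_weightE -mulf_div divff ?mul1r//.
by rewrite gt_eqF// expR_gt0.
Qed.

Let th_ge0 v j : 0 <= th v j. Proof. exact/ltW/theta_gt0. Qed.

(** Jensen's inequality for [u^q]: [t] is the tangent to [u^q] at [u = W v], evaluated at the Gibbs
    factor of [j]. *)
Let W_power v :
  expR (q * ln (W v)) <= \int[prior]_j expR (- (q * h j v) / beta).
Proof.
pose L := ln (W v).
have WE : expR (- L) = (W v)^-1 by rewrite expRN lnK ?posrE.
pose t j := expR (q * L) * (1 - q) +
  (expR (q * L) * q * expR (- L)) * expR (- h j v / beta).
have It : prior.-integrable setT (EFin \o t).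
  apply: integrableD_fun; first exact: integrable_cstP.
  exact: integrableZ_fun.
have <- : \int[prior]_j t j = expR (q * L).
  rewrite RintegralD//; [|exact: integrable_cstP|exact: integrableZ_fun].
  rewrite Rintegral_cstP RintegralZl// -/(W v) WE mulfVK ?gt_eqF//.
  by ring.
apply: le_Rintegral => //; first by apply: int_h; exact: ltW.
move=> j _; rewrite /t.
have := expR_ge_tangent (- h j v / beta - L) (_ : 0 <= n%:R^-1).
rewrite invr_ge0 (ltW n0) => /(_ isT); rewrite -/q => H.
have E : expR (- (q * h j v) / beta) =
    expR (q * L) * expR (q * (- h j v / beta - L)).
  by rewrite -expRD; congr expR; ring.
rewrite E; apply: le_trans (ler_wpM2l (expR_ge0 _) H).
rewrite (expRD (- h j v / beta)) le_eqVlt; apply/orP; left; apply/eqP.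
move: (expR (q * L)) (expR (- L)) (expR (- h j v / beta)) q => A B C p.
by ring.
Qed.

Let c (vz : n.-tuple R * n.-tuple R) : n.-tuple R :=
  [the n.-tuple R of mktuple (fun i => (tnth vz.1 i + tnth vz.2 i) / q)].

(** [gain] and [coef] are the exponent and the Laplace arguments in the hypothesis on [Psi] when
    [mu] is the atom at [j] and [mu'] the posterior. *)
Let coef v i j := 2 * (F j (x i) - fh v i) / beta.
Let gain v j := (loss v - sq j) / beta.
Let lin v z := \sum_(i < n) (2 * (f (x i) - fh v i) / beta) * tnth z i.
Let tilt v z j := th v j * expR (gain v j + \sum_(i < n) coef v i j * tnth z i).
Let U v z := \int[prior]_j tilt v z j.

(** The origin of [1 + 1/n]: in the quadratic part its surplus [1/n] yields exactly one [sq j], and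
    in the linear part [q] cancels the division in [c]. *)
Let h_c j v z : q * h j (c (v, z)) =
  h j v + sq j + \sum_(i < n) 2 * tnth z i * (f (x i) - F j (x i)).
Proof.
have nq : n%:R^-1 = q - 1 by rewrite /q addrC addKr.
rewrite /sq /sqdist_n nq /h !mulr_sumr -!big_split; apply: eq_bigr => i _.
rewrite tnth_mktuple /=; have := lt0r_neq0 q0.
move: q (tnth v i) (tnth z i) (f (x i)) (F j (x i)) => p a b r s p0.
by field.
Qed.

Let tiltE j v z : expR (- (q * h j (c (v, z))) / beta) =
  W v * expR (- (loss v / beta) - lin v z) * tilt v z j.
Proof.
have W0 := lt0r_neq0 (W_gt0 v).
have cancel (w a b e : R) : w != 0 -> w * a * (b / w * e) = a * b * e.
  by move=> w0; field.
rewrite /tilt thE cancel// -!expRD h_c; congr expR.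
have -> : \sum_(i < n) coef v i j * tnth z i = lin v z -
    (\sum_(i < n) 2 * tnth z i * (f (x i) - F j (x i))) / beta.
  rewrite /lin mulr_suml -sumrB; apply: eq_bigr => i _; rewrite /coef; ring.
rewrite /gain; ring.
Qed.

Let int_tilt v z : prior.-integrable setT (EFin \o tilt v z).
Proof.
rewrite (_ : tilt v z = fun j => (W v * expR (- (loss v / beta) - lin v z))^-1 *
    expR (- (q * h j (c (v, z))) / beta)).
  by apply: integrableZ_fun; apply: int_h; exact: ltW.
apply/funext => j; rewrite tiltE mulKf//.
by rewrite mulf_neq0// gt_eqF// expR_gt0.
Qed.

(** [W_power] and [tiltE] give [expR s <= U v z], where [s] is the left-hand side without its final
    [1]; then [1 + s <= expR s] removes the exponential, so that means can be taken term by term. *)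
Let lnW_drift v z :
  q * ln (W (c (v, z))) - ln (W v) + loss v / beta + lin v z + 1 <= U v z.
Proof.
have := W_power (c (v, z)); under eq_Rintegral do rewrite tiltE.
rewrite RintegralZl// -/(U v z) => H.
have := expR_ge1Dx (q * ln (W (c (v, z))) - ln (W v) + loss v / beta + lin v z).
rewrite addrC => /le_trans; apply.
rewrite -(ler_pM2l (_ : 0 < W v * expR (- (loss v / beta) - lin v z))); last first.
  by rewrite mulr_gt0// expR_gt0.
apply: le_trans H; rewrite -[X in X * _ * _]lnK ?posrE// -!expRD ler_expR.
move: (ln (W v)) (loss v / beta) (lin v z) (q * _) => a b r t.
by rewrite le_eqVlt; apply/orP; left; apply/eqP; ring.
Qed.

Section expectation.
Context d (T : measurableType d) (P : probability T R) (i1 : 'I_n).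
Variables (zeta : 'I_n -> {RV P >-> R}) (zeta_iid : iid zeta).
Variable Psi : probability nat R -> probability nat R -> R.
Hypothesis PsiP : forall mu mu' : probability nat R, P'L F x mu -> P'L F x mu' ->
  [/\ ((expR ((sqdist_n (f \o x) (fbar F mu' \o x)
         - sqdist_n (f \o x) (fbar F mu \o x)) / beta))%:E *
       \prod_(i < n) 'M_P (zeta i1) (2 * (fbar F mu (x i) - fbar F mu' (x i)) / beta)%R
       <= (Psi mu mu')%:E)%E,
      concave_on_P'L F x (Psi ^~ mu') & Psi mu mu = 1].

Lemma mmt_gen_fun_ge0 (Z : {RV P >-> R}) t : (0 <= 'M_P Z t)%E.
Proof. by apply: expectation_ge0 => w; exact: expR_ge0. Qed.

Lemma mmt_gen_fun_same_law i t :
  (\int[P]_w (expR (t * zeta i w))%:E = 'M_P (zeta i1) t)%E.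
Proof.
rewrite /mmt_gen_fun unlock.
have mu : measurable_fun setT (fun r : R => (expR (t * r))%:E).
  apply/measurable_EFinP; apply: measurableT_comp => //; exact: measurable_funM.
transitivity (\int[P]_w (expR (t * zeta i1 w))%:E)%E.
  apply: (same_law_integral (u := fun r => (expR (t * r))%:E)) => //.
  exact: (proj2 zeta_iid).
by apply: eq_integral => w _ /=; rewrite mulrC.
Qed.

(** [Q] has density [th v] with respect to the prior. Its mean function is the aggregate, which
    makes it the second argument to feed to [Psi]. *)
Let posterior v : exists Q : probability nat R,
  [/\ P'L F x Q, (forall j, fine (Q [set j]) = th v j * fine (prior [set j])) &
      forall i, fbar F Q (x i) = fh v i].
Proof.
have th1 : (\int[prior]_j (th v j)%:E = 1)%E.
  rewrite -EFin_Rintegral ?Rintegral_theta//; exact: integrable_theta.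
have mth : measurable_fun setT (th v) by [].
have [Q [QE Qint]] := density_probability mth (th_ge0 v) th1.
have pos i : (\int[Q]_j (maxe (F j (x i))%:E 0) =
    \int[prior]_j (maxe (th v j * F j (x i))%:E 0))%E.
  rewrite Qint//; last by move=> j; rewrite le_max lexx orbT.
  apply: eq_integral => j _; rewrite -EFin_max -EFinM -EFin_max; congr EFin.
  by rewrite mulrC maxr_pMr// mulr0.
have neg i : (\int[Q]_j (maxe (- (F j (x i))%:E) 0) =
    \int[prior]_j (maxe (- (th v j * F j (x i))%:E) 0))%E.
  rewrite Qint//; last by move=> j; rewrite le_max lexx orbT.
  apply: eq_integral => j _; rewrite -!EFinN -EFin_max -EFinM -EFin_max; congr EFin.
  by rewrite mulrC maxr_pMr// mulr0 mulrN.
exists Q; split.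
- move=> i; apply/integrableP; split => //.
  have /integrableP[_] := int1 (Y v) i; apply: le_lt_trans.
  rewrite Qint// le_eqVlt; apply/orP; left; apply/eqP.
  apply: eq_integral => j _; rewrite -EFinM /=; congr EFin.
  by rewrite normrM (ger0_norm (th_ge0 v j)) mulrC.
- move=> j; rewrite QE// integral_atom ?lee_fin//.
  by rewrite fineM// fin_num_measure.
- move=> i; rewrite /fbar /fh /ewa /Rintegral; congr fine.
  rewrite [LHS]integralE [RHS]integralE.
  by congr (_ - _)%E; rewrite unlock; [exact: pos|exact: neg].
Qed.

Let sqdistC (u w : 'I_n -> R) : sqdist_n u w = sqdist_n w u.
Proof.
by rewrite /sqdist_n; congr *%R; apply: eq_bigr => i _; rewrite -sqrrN opprB.
Qed.

(* The posterior [Q] given [v] is a mixture of the [dirac j], so that concavity of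
   [Psi ^~ Q] bounds the left-hand side by [Psi Q Q]. *)
Lemma expectation_tilt v : (\int[P]_w (U v (tuple_of_rv zeta w))%:E <= 1)%E.
Proof.
have [Q [PQ Qj fQ]] := posterior v.
have mt j : measurable_fun setT (fun w => (tilt v (tuple_of_rv zeta w) j)%:E).
  apply/measurable_EFinP; apply: measurable_funM => //; apply: measurableT_comp => //.
  apply: measurable_funD => //; apply: measurable_sum => i.
  apply: measurable_funM => //.
  by apply: (measurableT_comp (measurable_tnth i)); exact: measurable_tuple_of_rv.
have t0 j w : (0 <= (tilt v (tuple_of_rv zeta w) j)%:E)%E.
  by rewrite lee_fin mulr_ge0// expR_ge0.
under eq_integral => w _.
  rewrite EFin_Rintegral; last exact: int_tilt.
  rewrite ge0_integral_nat//; over.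
rewrite integral_nneseries//; last 2 first.
- by move=> j; exact: emeasurable_funM.
- by move=> j w _; rewrite mule_ge0.
pose psi (mu : probability nat R) := Psi mu Q.
(* [psi] dominates a product of an exponential and Laplace transforms. *)
have psi0 mu : P'L F x mu -> 0 <= psi mu.
  move=> Pmu; rewrite -lee_fin; have [le _ _] := PsiP Pmu PQ.
  apply: le_trans le; rewrite mule_ge0 ?lee_fin ?expR_ge0//.
  by apply: prode_ge0 => i _; exact: mmt_gen_fun_ge0.
have cpsi : concave_on_P'L F x psi by have [] := PsiP PQ PQ.
have psi1 : psi Q = 1 by have [] := PsiP PQ PQ.
(* The hypothesis on [Psi] at the atom [j]; independence of the [zeta i] turns the exponential of a
   sum into the product of Laplace transforms. *)
have term j : (\int[P]_w ((tilt v (tuple_of_rv zeta w) j)%:E * prior [set j]) <=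
    (fine (Q [set j]) * psi (dirac j))%:E)%E.
  rewrite ge0_integralZr//.
  have [le _ _] := PsiP (P'L_dirac x F j) PQ.
  have fd i : fbar F (dirac j : probability nat R) (x i) = F j (x i).
    by rewrite /fbar /Rintegral integral_dirac// diracT mul1e.
  have -> : (\int[P]_w (tilt v (tuple_of_rv zeta w) j)%:E =
      (th v j)%:E * ((expR (gain v j))%:E * \prod_(i < n) 'M_P (zeta i1) (coef v i j)))%E.
    have me i : measurable_fun setT (fun r : R => (expR (coef v i j * r))%:E).
      by apply/measurable_EFinP; apply: measurableT_comp => //; exact: measurable_funM.
    under [X in (_ = _ * (_ * X))%E]eq_bigr => i _.
      rewrite -(mmt_gen_fun_same_law i); over.
    rewrite /= -(expectation_prod_independent
      (u := fun i r => (expR (coef v i j * r))%:E) (proj1 zeta_iid))//.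
    pose pe w := \prod_(i < n) expR (coef v i j * zeta i w).
    have mpe : measurable_fun setT (EFin \o pe).
      apply/measurable_EFinP; apply: measurable_prod => i _.
      by apply: measurableT_comp => //; exact: measurable_funM.
    have pe0 w : (0 <= (pe w)%:E)%E.
      by rewrite lee_fin; apply: prodr_ge0 => i _; exact: expR_ge0.
    under [X in (_ = _ * (_ * X))%E]eq_integral do rewrite prodEFin.
    rewrite muleA -EFinM -(ge0_integralZl P measurableT mpe)//.
    - apply: eq_integral => w _; rewrite /= -EFinM; congr EFin.
      rewrite /tilt expRD mulrA; congr *%R; rewrite /pe expR_sum.
      by apply: eq_bigr => i _; rewrite tnth_mktuple.
    - by move=> w _; exact: pe0.
    - by rewrite lee_fin mulr_ge0// expR_ge0.
  have -> : ((fine (Q [set j]) * psi (dirac j))%:E =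
      (th v j * psi (dirac j))%:E * prior [set j])%E.
    by rewrite Qj -[prior [set j] in RHS]fineK ?fin_num_measure// -EFinM mulrAC.
  apply: lee_wpmul2r => //; rewrite [leRHS]EFinM.
  apply: lee_wpmul2l; first by rewrite lee_fin.
  apply: le_trans le; rewrite le_eqVlt; apply/orP; left; apply/eqP.
  have eQ : fbar F Q \o x = fh v by apply/funext => i; exact: fQ.
  have ed : fbar F (dirac j : probability nat R) \o x = F j \o x.
    by apply/funext => i; exact: fd.
  rewrite eQ ed (sqdistC (f \o x) (fh v)) (sqdistC (f \o x) (F j \o x)).
  by under [in RHS]eq_bigr do rewrite fd fQ.
apply: (@le_trans _ _ (\sum_(j <oo) (fine (Q [set j]) * psi (dirac j))%:E)%E).
  apply: lee_nneseries => [j _ _|j _]; last exact: term.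
  by apply: integral_ge0 => w _; rewrite mule_ge0.
apply: lime_le.
  apply: is_cvg_nneseries => j _ _; rewrite lee_fin mulr_ge0 ?fine_ge0//.
  by apply: psi0; exact: P'L_dirac.
apply: nearW => N; rewrite sumEFin lee_fin big_mkord -psi1.
exact: (concave_sum_atoms cpsi psi0 N PQ).
Qed.

Hypothesis zeta_int : forall i, P.-integrable setT (EFin \o zeta i).
Hypothesis zeta_mean0 : forall i, \int[P]_w zeta i w = 0.
Variables (k : nat) (pk : (0 < prior [set k])%E).

Let pik := fine (prior [set k]).

Let pik_gt0 : 0 < pik.
Proof. by rewrite fine_gt0// pk ltey_eq fin_num_measure. Qed.

Let D v := ln (W v) - (ln pik - h k v / beta).
Let b := sq k / beta - ln pik / n%:R.

Let b_ge0 : 0 <= b.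
Proof.
have pik1 : pik <= 1 by rewrite -lee_fin fineK ?fin_num_measure// probability_le1.
rewrite subr_ge0 (@le_trans _ _ 0)//.
  by apply: mulr_le0_ge0; [exact: ln_le0|rewrite invr_ge0 ltW].
apply: divr_ge0; last exact: ltW.
apply: mulr_ge0; first by rewrite invr_ge0 ltW.
by apply: sumr_ge0 => i _; exact: sqr_ge0.
Qed.

Let D_ge0 v : 0 <= D v.
Proof.
rewrite subr_ge0 -[h k v / beta]opprK -mulNr opprK.
rewrite -[X in _ + X]expRK -lnM ?posrE ?expR_gt0// ler_ln ?posrE ?mulr_gt0 ?expR_gt0//.
rewrite -lee_fin EFin_Rintegral// EFinM fineK ?fin_num_measure// muleC.
by apply: (@ge0_integral_nat_atom _ prior (fun j => (expR (- h j v / beta))%:E)).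
Qed.

Let m_h j : measurable_fun setT (h j).
Proof.
apply: measurable_sum => i; apply: measurable_funD => //.
apply: measurable_funM => //; apply: measurable_funM => //.
exact: measurable_tnth.
Qed.

Let m_W : measurable_fun setT W.
Proof.
apply: (@measurable_Rintegral_nat _ _ _ _ (fun v j => expR (- h j v / beta))) => j.
apply: measurableT_comp => //; apply: measurable_funM => //.
exact: measurableT_comp.
Qed.

Let m_D : measurable_fun setT D.
Proof.
apply: measurable_funB; first exact: measurableT_comp.
by apply: measurable_funB => //; exact: measurable_funM.
Qed.

Let m_loss : measurable_fun setT loss.
Proof.
apply: measurable_funM => //; apply: measurable_sum => i.
apply: measurable_funX; apply: measurable_funB => //.
apply: measurable_ewa => // i'; apply: measurable_funD => //.
exact: measurable_tnth.
Qed.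

Let m_c : measurable_fun setT c.
Proof.
apply: (measurable_mktuple (f := fun i (vz : n.-tuple R * n.-tuple R) =>
  (tnth vz.1 i + tnth vz.2 i) / q)) => i.
apply: measurable_funM => //; apply: measurable_funD.
  by apply: (measurableT_comp (measurable_tnth i)).
by apply: (measurableT_comp (measurable_tnth i)).
Qed.

Let m_U v : measurable_fun setT (fun w => U v (tuple_of_rv zeta w)).
Proof.
apply: (@measurable_Rintegral_nat _ _ _ _ (fun w j => tilt v (tuple_of_rv zeta w) j)) => j.
apply: measurable_funM => //; apply: measurableT_comp => //.
apply: measurable_funD => //; apply: measurable_sum => i.
apply: measurable_funM => //.
by apply: (measurableT_comp (measurable_tnth i)); exact: measurable_tuple_of_rv.
Qed.

Let U_ge0 v z : 0 <= U v z.
Proof. by apply: Rintegral_ge0 => j _; rewrite mulr_ge0// expR_ge0. Qed.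

Let int_U v : P.-integrable setT (EFin \o (fun w => U v (tuple_of_rv zeta w))).
Proof.
apply: integrable_ge0_lty => //.
exact: le_lt_trans (expectation_tilt v) (ltry 1).
Qed.

Let kap v i := 2 * (f (x i) - F k (x i)) / beta - 2 * (f (x i) - fh v i) / beta.

(** The surplus [1/n] in [q] produces [b]: [h_c] contributes [sq k], and [q * ln pik] contributes
    [ln pik / n]. The last group has nonpositive mean, since [U] has mean at most one and [zeta] is
    centred. *)
Let D_drift v z : q * D (c (v, z)) <=
  (D v - loss v / beta + b) + ((U v z - 1) + \sum_(i < n) kap v i * tnth z i).
Proof.
have -> : \sum_(i < n) kap v i * tnth z i =
    (\sum_(i < n) 2 * tnth z i * (f (x i) - F k (x i))) / beta - lin v z.
  rewrite /lin mulr_suml -sumrB; apply: eq_bigr => i _; rewrite /kap; ring.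
have H := lnW_drift v z.
have -> : q * D (c (v, z)) = q * ln (W (c (v, z))) - ln pik - ln pik / n%:R +
    q * h k (c (v, z)) / beta by rewrite /D /q; ring.
rewrite h_c /D /b.
rewrite [(h k v + sq k + _) / beta]mulrDl [(h k v + sq k) / beta]mulrDl.
move: H; move: (h k v / beta) (sq k / beta) (_ / beta) (loss v / beta)
  (ln pik / n%:R) (ln pik) (lin v z) (U v z) (ln (W v)) (q * _).
by move=> *; lra.
Qed.

Let drift v : (\int[P]_w (D (c (v, tuple_of_rv zeta w)))%:E <=
  ((D v - loss v / beta + b) / q)%:E)%E.
Proof.
pose C := D v - loss v / beta + b.
pose lz w := \sum_(i < n) kap v i * zeta i w.
have Ilz : P.-integrable setT (EFin \o lz).
  by apply: integrable_sum_fun => i; exact: integrableZ_fun.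
(* Integrable majorant of [D (c (v, zeta))]: the right-hand side of [D_drift] over [q]. *)
pose r w := q^-1 * (C + ((U v (tuple_of_rv zeta w) - 1) + lz w)).
have IU1 : P.-integrable setT (EFin \o (fun w => U v (tuple_of_rv zeta w) - 1)).
  by apply: integrableB_fun => //; exact: integrable_cstP.
have IU2 : P.-integrable setT (EFin \o (fun w => (U v (tuple_of_rv zeta w) - 1) + lz w)).
  exact: integrableD_fun.
have IU3 : P.-integrable setT
    (EFin \o (fun w => C + ((U v (tuple_of_rv zeta w) - 1) + lz w))).
  by apply: integrableD_fun => //; exact: integrable_cstP.
have Ir : P.-integrable setT (EFin \o r) by exact: integrableZ_fun.
have Er : \int[P]_w r w <= C / q.
  rewrite RintegralZl// mulrC ler_pM2r ?invr_gt0//.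
  rewrite RintegralD//; last exact: integrable_cstP.
  rewrite [X in X + _]Rintegral_cstP.
  rewrite RintegralD// RintegralB//; last exact: integrable_cstP.
  rewrite Rintegral_cstP Rintegral_sum; last by move=> i; exact: integrableZ_fun.
  rewrite big1 ?addr0; last first.
    by move=> i _; rewrite RintegralZl ?zeta_mean0 ?mulr0//; exact: zeta_int.
  rewrite gerDl subr_le0 -lee_fin EFin_Rintegral//; exact: expectation_tilt.
apply: (@le_trans _ _ (\int[P]_w (r w)%:E)%E); last by rewrite -EFin_Rintegral// lee_fin.
apply: ge0_le_integral => //.
- by move=> w _; rewrite lee_fin.
- apply/measurable_EFinP; apply: (measurableT_comp m_D).
  apply: (measurableT_comp m_c); apply: measurable_fun_pair => //.
  exact: measurable_tuple_of_rv.
- exact: measurable_int Ir.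
- move=> w _; rewrite lee_fin /r -(ler_pM2l q0) mulVKf ?gt_eqF//.
  apply: le_trans (D_drift _ _) _; rewrite lerD2l lerD2l /lz.
  rewrite le_eqVlt; apply/orP; left; apply/eqP.
  by apply: eq_bigr => i _; rewrite tnth_mktuple.
Qed.

Variables (eta : 'I_n -> {RV P >-> R}) (eta_iid : iid eta).
Hypothesis indep : independent_pair P (tuple_of_rv zeta) (tuple_of_rv eta).
Hypothesis law1 : same_law P (fun w => eta i1 w + zeta i1 w)
  P (fun w => (1 + n%:R^-1) * eta i1 w).

Lemma gibbs_risk_II :
  (\int[P]_w (sqdist_n (fun i => ewa F x beta prior (fun i => f (x i) + eta i w) (x i))
      (f \o x))%:E <=
   (sqdist_n (F k \o x) (f \o x) - beta * ln (fine (prior [set k])) / n%:R)%:E)%E.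
Proof.
have m_lossb : measurable_fun setT (fun v => loss v / beta) by exact: measurable_funM.
have loss_ge0 v : 0 <= loss v.
  apply: mulr_ge0; first by rewrite invr_ge0 ltW.
  by apply: sumr_ge0 => i _; exact: sqr_ge0.
have lossb_ge0 v : 0 <= loss v / beta by rewrite divr_ge0// ltW.
have mV := measurable_tuple_of_rv eta; have mZ := measurable_tuple_of_rv zeta.
have cV : same_law P (fun w => c (tuple_of_rv eta w, tuple_of_rv zeta w))
    P (tuple_of_rv eta).
  have := scaled_sum_same_law eta_iid zeta_iid (lt0r_neq0 q0) indep law1.
  rewrite (_ : (fun w => _) = fun w => c (tuple_of_rv eta w, tuple_of_rv zeta w))//.
  apply/funext => w; apply: eq_from_tnth => i.
  by rewrite !tnth_mktuple.
have H := drift_bound mV mZ (independent_pair_sym indep) m_c m_D m_lossb D_ge0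
  lossb_ge0 q1 b_ge0 cV drift.
rewrite (_ : (fun w => _) = fun w =>
    (beta%:E * (loss (tuple_of_rv eta w) / beta)%:E)%E); last first.
  apply/funext => w; rewrite -EFinM; congr EFin.
  have -> : (fun i => ewa F x beta prior (fun i => f (x i) + eta i w) (x i)) =
      fh (tuple_of_rv eta w).
    apply/funext => i; rewrite /fh (_ : Y _ = fun i => f (x i) + eta i w)//.
    by apply/funext => i'; rewrite /Y tnth_mktuple.
  by rewrite [RHS]mulrC divfK// gt_eqF.
rewrite ge0_integralZl//; last 3 first.
- by apply/measurable_EFinP; exact: (measurableT_comp m_lossb).
- by move=> w _; rewrite lee_fin.
- by rewrite lee_fin ltW.
apply: (@le_trans _ _ (beta%:E * b%:E)%E).
  by apply: lee_wpmul2l => //; rewrite lee_fin ltW.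
rewrite -EFinM lee_fin /b mulrBr mulrCA divff ?gt_eqF// mulr1 -/(sq k) -/pik.
by rewrite mulrA.
Qed.

End expectation.

End case_II.

(** * Transfer to the stated assumptions and the oracle inequality *)

Lemma same_law_Rintegral d (T : measurableType d) (R : realType)
    (P : probability T R) d' (T' : measurableType d') (P' : probability T' R)
    dE (E : measurableType dE) (X : T -> E) (Y : T' -> E) (u : E -> R) :
  measurable_fun setT X -> measurable_fun setT Y -> same_law P X P' Y ->
  measurable_fun setT u ->
  \int[P]_w u (X w) = \int[P']_w u (Y w).
Proof.
move=> mX mY XY mu; rewrite /Rintegral; congr fine.
rewrite [LHS]integralE [RHS]integralE; congr (_ - _)%E; rewrite unlock.
  apply: (same_law_integral (u := fun z => maxe (u z)%:E 0%E)) => //.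
    by apply: measurable_maxe => //; exact/measurable_EFinP.
  by move=> r; rewrite le_max lexx orbT.
apply: (same_law_integral (u := fun z => maxe (- (u z)%:E)%E 0%E)) => //.
  apply: measurable_maxe => //; apply: measurableT_comp => //.
  exact/measurable_EFinP.
by move=> r; rewrite le_max lexx orbT.
Qed.

Section risk_bound.
Context (R : realType) (X : Type) (n : nat) (n_gt0 : (0 < n)%N).
Context (d : measure_display) (Om : measurableType d) (P : probability Om R).
Variables (x : 'I_n -> X) (f : X -> R) (F : nat -> X -> R).
Variables (xi : 'I_n -> {RV P >-> R}) (xi_iid : iid xi).
Hypothesis xi_integrable : forall i, P.-integrable setT (fun w => (xi i w)%:E).
Hypothesis xi_mean0 : forall i, ('E_P[xi i] = 0)%E.
Variables (prior : probability nat R) (beta0 beta : R).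
Hypotheses (beta_gt0 : 0 < beta) (beta_ge : beta0 <= beta).
Variables (k : nat) (pk : (0 < prior [set k])%E).

Let i1 : 'I_n := Ordinal n_gt0.

Let bound := sqdist_n (F k \o x) (f \o x) - beta * ln (fine (prior [set k])) / n%:R.

(** [m_fun] depends only on the law. Assumption (I) speaks of the first noise, whereas Stein's
    inequality is applied to each of them. *)
Lemma same_law_m_fun i z : m_fun (xi i) z = m_fun (xi i1) z.
Proof.
have iX i' : P.-integrable setT (EFin \o xi i') := xi_integrable i'.
apply: EFin_inj; rewrite !m_funE//.
pose u (r : R) : \bar R := (if 0 <= z then (if z < r then r else 0)
  else (if r <= z then - r else 0))%:E.
apply: (same_law_integral (u := u)) => //.
- exact: (proj2 xi_iid).
- apply/measurable_EFinP; case: (0 <= z); apply: measurable_fun_ifT => //.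
  + exact: measurable_fun_ltr.
  + exact: measurable_fun_ler.
- move=> r; rewrite lee_fin; case: ifPn => z0; case: ifPn => // zr.
    by rewrite (le_trans z0)// ltW.
  by rewrite oppr_ge0 (le_trans zr)// ltW// ltNge.
Qed.

Lemma risk_bound_I : assumption_I n_gt0 x F xi prior beta0 ->
  ('E_P[fun w => sqdist_n (ewa F x beta prior (fun i => f (x i) + xi i w)%R \o x)
     (f \o x)] <= bound%:E)%E.
Proof.
move=> [int2 xi2 [g [mg g0 ubg mfun_g b0]]].
have xi_sq i : P.-integrable setT (EFin \o (fun w => xi i w ^+ 2)).
  apply: integrable_ge0_lty => //.
  - exact: measurable_funX.
  - by move=> w; exact: sqr_ge0.
  - rewrite (same_law_integral (Y := xi i1) (P' := P) (u := fun r => (r ^+ 2)%:E))//.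
    + by move: xi2; rewrite unlock.
    + exact: (proj2 xi_iid).
    + by apply/measurable_EFinP; exact: measurable_funX.
    + by move=> r; rewrite lee_fin sqr_ge0.
have gsup z : g z <= sup (range g).
  by apply: ub_le_sup => //; exists z.
have Gbeta : 4 * sup (range g) <= beta by rewrite -b0.
have mfun_gi i a b : (\int[lebesgue_measure]_(z in `]a, b]) (m_fun (xi i) z)%:E =
    \int[distribution P (xi i)]_(z in `]a, b]) (g z)%:E)%E.
  under eq_integral do rewrite same_law_m_fun.
  rewrite mfun_g; apply: eq_measure_integral => A mA _.
  by apply: (proj2 xi_iid).
exact: (gibbs_risk_I n_gt0 f xi_iid xi_integrable xi_mean0 beta_gt0
  (fun y i => int2 y beta beta_gt0 i) xi_sq mg g0 gsup Gbeta mfun_gi pk).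
Qed.

Lemma risk_bound_II : assumption_II n_gt0 x f F xi prior beta0 ->
  ('E_P[fun w => sqdist_n (ewa F x beta prior (fun i => f (x i) + xi i w)%R \o x)
     (f \o x)] <= bound%:E)%E.
Proof.
move=> [int1 b0 [d' [Om' [P' [pr [zeta [prP zeta_iid sumlaw indep]]]]]]].
move=> /(_ beta beta_ge)[Psi PsiP].
have mpr : measurable_fun setT pr by exact: measurable_funP.
have prlaw : same_law P' pr P id by move=> A mA; exact: prP.
(* The noise as seen on the enlargement; it inherits the joint law of [xi] because [pr] carries [P']
   to [P]. *)
pose eta i : {RV P' >-> R} := [the {mfun Om' >-> R} of xi i \o pr].
have mxi i (A : set R) : measurable A -> measurable (xi i @^-1` A).
  move=> mA; have mf : measurable_fun setT (xi i) by [].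
  by rewrite -[X in measurable X]setTI; exact: (mf measurableT A mA).
have etaE i (A : set R) : measurable A -> P' (eta i @^-1` A) = P (xi i @^-1` A).
  by move=> mA; rewrite -prP//; exact: mxi.
have eta_iid : iid eta.
  split.
    move=> J A mA; rewrite (eq_bigr (fun i => P (xi i @^-1` A i))); last first.
      by move=> i iJ; rewrite etaE//; exact: mA.
    rewrite -(proj1 xi_iid)// -prP; last first.
      by apply: fin_bigcap_measurable => // i /= iJ; apply: mxi; exact: mA.
    by congr (P' _); rewrite preimage_bigcap.
  by move=> i j A mA; rewrite !etaE//; exact: (proj2 xi_iid).
have eta_int i : P'.-integrable setT (EFin \o eta i).
  apply/integrableP; split; first exact/measurable_EFinP.
  have /integrableP[_] := xi_integrable i; apply: le_lt_trans.
  rewrite (same_law_integral (X := pr) (Y := id) (P' := P)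
    (u := fun w => `|(xi i w)%:E|%E))//.
  by apply: measurableT_comp => //; exact/measurable_EFinP.
have eta_mean i : \int[P']_w eta i w = 0.
  have := xi_mean0 i; rewrite unlock => E0.
  rewrite (same_law_Rintegral (X := pr) (Y := id) (P' := P) (u := xi i))//.
  by rewrite /Rintegral E0.
have law1 : same_law P' (fun w => eta i1 w + zeta i1 w)
    P' (fun w => (1 + n%:R^-1) * eta i1 w).
  move=> A mA; rewrite (sumlaw A mA).
  have mc : measurable ((fun w => (1 + n%:R^-1) * xi i1 w) @^-1` A).
    have mf : measurable_fun setT (fun w => (1 + n%:R^-1) * xi i1 w).
      exact: measurable_funM.
    by rewrite -[X in measurable X]setTI; exact: (mf measurableT A mA).
  by rewrite -(prP _ mc).
(* The moments of [zeta] are derived from [zeta = (eta + zeta) - eta]: the sum has the law of a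
   multiple of [eta], hence is integrable and centred. *)
have sum_int : P'.-integrable setT (EFin \o (fun w => eta i1 w + zeta i1 w)).
  apply/integrableP; split; first by apply/measurable_EFinP; exact: measurable_funD.
  rewrite (same_law_integral (u := fun r : R => `|r%:E|%E) _ _ law1)//; last 3 first.
  - exact: measurable_funD.
  - exact: measurable_funM.
  - by apply: measurableT_comp => //; exact/measurable_EFinP.
  have /integrableP[_] := integrableZ_fun (1 + n%:R^-1) (eta_int i1).
  exact.
have zeta1_int : P'.-integrable setT (EFin \o zeta i1).
  have := integrableB_fun sum_int (eta_int i1); apply: eq_integrable => // w _ /=.
  by congr EFin; rewrite addrC addKr.
have zeta_int i : P'.-integrable setT (EFin \o zeta i).
  apply/integrableP; split; first exact/measurable_EFinP.
  rewrite (same_law_integral (u := fun r : R => `|r%:E|%E) _ _ (proj2 zeta_iid i i1))//.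
    by have /integrableP[] := zeta1_int.
  by apply: measurableT_comp => //; exact/measurable_EFinP.
have zeta_mean i : \int[P']_w zeta i w = 0.
  rewrite (same_law_Rintegral (P' := P') (Y := zeta i1) (u := id))//;
    last exact: (proj2 zeta_iid).
  have : \int[P']_w (eta i1 w + zeta i1 w) = 0.
    rewrite (same_law_Rintegral (P' := P') (u := id)
      (Y := fun w => (1 + n%:R^-1) * eta i1 w))//.
    - by rewrite RintegralZl// eta_mean mulr0.
    - exact: measurable_funD.
    - exact: measurable_funM.
  by rewrite RintegralD// eta_mean add0r.
have int1' (y : 'I_n -> R) i : prior.-integrable setT
    (fun j => (theta F x beta prior y j * F j (x i))%:E) by exact: int1.
have PsiP' mu mu' : P'L F x mu -> P'L F x mu' ->
  [/\ ((expR ((sqdist_n (f \o x) (fbar F mu' \o x)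
         - sqdist_n (f \o x) (fbar F mu \o x)) / beta))%:E *
       \prod_(i < n) 'M_P' (zeta i1) (2 * (fbar F mu (x i) - fbar F mu' (x i)) / beta)%R
       <= (Psi mu mu')%:E)%E,
      concave_on_P'L F x (Psi ^~ mu') & Psi mu mu = 1].
  by move=> Pm Pm'; have [? ? _ ?] := PsiP _ _ Pm Pm'; split.
have := gibbs_risk_II n_gt0 beta_gt0 int1' zeta_iid PsiP' zeta_int zeta_mean pk
  eta_iid indep law1.
(* The loss is a function of [xi], so its mean over the enlargement through [pr] is its mean over
   [Om]. *)
rewrite unlock; apply: le_trans; rewrite le_eqVlt; apply/orP; left; apply/eqP.
apply/esym; apply: (same_law_integral (X := pr) (Y := id) (u := fun w =>
  (sqdist_n (ewa F x beta prior (fun i => f (x i) + xi i w)%R \o x) (f \o x))%:E)) => //.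
- apply/measurable_EFinP; apply: measurable_funM => //; apply: measurable_sum => i.
  apply: measurable_funX; apply: measurable_funB => //.
  by apply: measurable_ewa => // i'; exact: measurable_funD.
- move=> w; rewrite lee_fin mulr_ge0 ?invr_ge0//.
  by apply: sumr_ge0 => i _; exact: sqr_ge0.
Qed.

End risk_bound.

(* Lambda = {1, 2, 3, ...} is represented by nat with its discrete
   sigma-algebra: the index k : nat stands for the element j = k + 1. *)
Theorem theorem3 (R : realType) (X : Type) (n : nat) (n_gt0 : (0 < n)%N)
    (d : measure_display) (Om : measurableType d) (P : probability Om R)
    (x : 'I_n -> X) (f : X -> R) (F : nat -> X -> R)
    (xi : 'I_n -> {RV P >-> R})
    (xi_iid : iid xi)
    (xi_integrable : forall i, P.-integrable setT (fun w => (xi i w)%:E))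
    (xi_mean0 : forall i, ('E_P[xi i] = 0)%E)
    (prior : probability nat R) (beta0 : R)
    (H : assumption_I n_gt0 x F xi prior beta0 \/
         assumption_II n_gt0 x f F xi prior beta0)
    (beta : R) (beta_gt0 : 0 < beta) (beta_ge : beta0 <= beta) :
  let Y := fun (w : Om) (i : 'I_n) => f (x i) + xi i w in
  let risk := ('E_P[fun w =>
                sqdist_n (ewa F x beta prior (Y w) \o x) (f \o x)])%E in
  (risk <= ereal_inf (range (fun j : nat =>
     (sqdist_n (F j \o x) (f \o x))%:E +
     beta%:E * lne (prior [set j])^-1 / n%:R%:E)))%E
  /\
  (forall M : nat, (0 < M)%N ->
     (forall j : nat, (j < M)%N -> prior [set j] = (M%:R^-1)%:E) ->
     (risk <= \big[Order.min/+oo]_(j < M) (sqdist_n (F j \o x) (f \o x))%:E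
              + (beta * ln M%:R / n%:R)%R%:E)%E).
Proof.
move=> Y risk.
have core k : (0 < prior [set k])%E -> (risk <= (sqdist_n (F k \o x) (f \o x) -
    beta * ln (fine (prior [set k])) / n%:R)%:E)%E.
  by move=> pk; case: H => H; [exact: risk_bound_I H|exact: risk_bound_II H].
have n0 : 0 < n%:R :> R by rewrite ltr0n.
have nV : (n%:R%:E^-1 = (n%:R^-1)%:E :> \bar R)%E by rewrite inver gt_eqF.
split.
  apply: le_ereal_inf_tmp => _ [j _ <-]; rewrite nV.
  have [pj|] := ltP 0%E (prior [set j]); last first.
    (* At a null atom the inverse in [\bar R] is [+oo], and so is its logarithm: the bound is
       trivial. *)
    rewrite measure_le0 => /eqP ->; rewrite inve0 gt0_muley ?lte_fin//.
    by rewrite gt0_mulye ?lte_fin ?invr_gt0// addey// leey.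
  apply: le_trans (core j pj) _.
  have fj : prior [set j] = (fine (prior [set j]))%:E.
    by rewrite fineK// fin_num_measure.
  have pj' : 0 < fine (prior [set j]) by rewrite -lte_fin -fj.
  have -> : lne (prior [set j])^-1 = (- ln (fine (prior [set j])))%:E.
    by rewrite {1}fj inver gt_eqF// lne_EFin ?invr_gt0// lnV.
  by rewrite -!EFinM -EFinD lee_fin mulrN mulNr.
move=> M M0 pM.
have E j : (j < M)%N -> (risk - (beta * ln M%:R / n%:R)%:E <=
    (sqdist_n (F j \o x) (f \o x))%:E)%E.
  move=> jM; have M0' : 0 < M%:R :> R by rewrite ltr0n.
  rewrite leeBlDr//; apply: le_trans (core j _) _; rewrite pM ?lte_fin ?invr_gt0//.
  by rewrite -EFinD lee_fin /= lnV ?posrE// mulrN mulNr opprK.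
(* With the penalty moved to the left, the inequality is stable under [min] and holds at the neutral
   value [+oo]. *)
rewrite -leeBlDr//; elim/big_ind: _ => [|a b Ha Hb|j _].
- by rewrite leey.
- by rewrite le_min Ha.
- exact: E.
Qed.
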